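(* Let $X$ be a Banach lattice with order continuous norm and let $Z$ be an ordered Banach space. Assume that there exist a positive bijection $S \in \mathcal{L}(Z,X)$, a positive operator $J \in \mathcal{L}(X,Z)$ and a sequence of positive operators $(R_n) \subseteq \mathcal{L}(Z,X)$ such that $(JR_n) \subseteq \mathcal{L}(Z)$ converges to $\operatorname{id}_Z$ with respect to the strong operator topology. (a) The space $\operatorname{span}(Z_+)$ is a Banach lattice with order continuous norm with respect to a norm that is equivalent to $\|\cdot\|_{\operatorname{span}(Z_+)}$. (b) If $X$ is a KB-space, then so is $\operatorname{span}(Z_+)$. (c) If the sequence $(R_nJ) \subseteq \mathcal{L}(X)$ converges to $\operatorname{id}_X$ with respect to the weak operator topology, then $J$ is a lattice homomorphism from $X$ to $\operatorname{span}(Z_+)$ and $JX$ is a lattice ideal in $\operatorname{span}(Z_+)$.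
   Context: All spaces are real. A cone in a real vector space $X$ is a non-empty set $X_+\subseteq X$ with $\alpha X_+ + \beta X_+ \subseteq X_+$ for all real $\alpha,\beta\ge 0$ and $X_+\cap(-X_+)=\{0\}$; it induces the order $x\le y :\Leftrightarrow y-x\in X_+$. An ordered Banach space is a Banach space with a norm-closed cone. For an ordered Banach space $Z$ one has $\operatorname{span}(Z_+)=Z_+-Z_+$; this space is ordered by the cone $Z_+$ and endowed with the complete norm $$\|x\|_{\operatorname{span}(Z_+)} := \inf\{\|y\|+\|z\| : y,z\in Z_+,\ x=y-z\}.$$ A vector lattice is an ordered vector space in which any two elements have a supremum; $|x|:=\sup\{x,-x\}$. A Banach lattice is an ordered Banach space that is a vector lattice such that $|x|\le|y|$ implies $\|x\|\le\|y\|$. A Banach lattice $X$ has order continuous norm if every increasing and order bounded net (equivalently, sequence) in $X_+$ is norm convergent. A KB-space is a Banach lattice in which every increasing norm-bounded net (equivalently, sequence) is norm-convergent. A subspace $I$ of a vector lattice $Z$ is a lattice ideal if $|x|\le|y|$ with $x \in Z$, $y\in I$ implies $x\in I$. $\mathcal{L}(X,Z)$ is the space of bounded linear operators from $X$ to $Z$, $\mathcal{L}(X):=\mathcal{L}(X,X)$; a linear map $T:X\to Z$ is positive if $TX_+\subseteq Z_+$. The inverse $S^{-1}$ of the positive bijection $S$ is not assumed to be positive. *)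

(* Defs.v *)
From HB Require Import structures.
From mathcomp Require Import all_boot all_order all_algebra.
From mathcomp Require Import all_classical all_reals all_analysis.

Set Implicit Arguments.
Unset Strict Implicit.
Unset Printing Implicit Defensive.

Import Order.TTheory GRing.Theory Num.Theory.
Import numFieldNormedType.Exports.

Local Open Scope classical_set_scope.
Local Open Scope ring_scope.

Section cone.
Context {R : realType} {V : lmodType R}.
Implicit Types (K I : set V) (x y s : V).

Definition is_cone K :=
  [/\ K !=set0,
      forall (a b : R) x y, 0 <= a -> 0 <= b -> K x -> K y ->
        K (a *: x + b *: y)
    & K `&` [set - x | x in K] = [set 0]].

Definition cone_le K x y := K (y - x).

Definition is_sup2 K x y s :=
  [/\ cone_le K x s, cone_le K y s
    & forall u, cone_le K x u -> cone_le K y u -> cone_le K s u].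

Definition is_inf2 K x y s :=
  [/\ cone_le K s x, cone_le K s y
    & forall u, cone_le K u x -> cone_le K u y -> cone_le K u s].

Definition vector_lattice K := forall x y, exists s, is_sup2 K x y s.

(* [is_modulus K x a] means a = |x|; the modulus is unique when K is a cone. *)
Definition is_modulus K x a := is_sup2 K x (- x) a.

Definition lattice_ideal K I :=
  submod_closed [in I] /\
  forall x y a b, is_modulus K x a -> is_modulus K y b ->
    cone_le K a b -> I y -> I x.

(* Nets: families indexed by a non-empty directed preordered type. *)
Definition directed (T : Type) (le : T -> T -> Prop) :=
  [/\ inhabited T, forall i, le i i,
      forall i j k, le i j -> le j k -> le i k
    & forall i j, exists k, le i k /\ le j k].

Definition increasing_net K (T : Type) (le : T -> T -> Prop) (x : T -> V) :=
  forall i j, le i j -> cone_le K (x i) (x j).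

Definition order_bounded_net K (T : Type) (x : T -> V) :=
  exists a b, forall i, cone_le K a (x i) /\ cone_le K (x i) b.

End cone.

(* The filter of tails, so that [x @ net_tails le --> l] is net convergence. *)
Definition net_tails (T : Type) (le : T -> T -> Prop) : set_system T :=
  [set A | exists i, forall j, le i j -> A j].

Definition positive_map {R : realType} {V W : lmodType R}
    (KV : set V) (KW : set W) (f : V -> W) :=
  forall x, KV x -> KW (f x).

Definition lattice_homomorphism {R : realType} {V W : lmodType R}
    (KV : set V) (KW : set W) (f : {linear V -> W}) :=
  (forall x y s, is_sup2 KV x y s -> is_sup2 KW (f x) (f y) (f s)) /\
  (forall x y s, is_inf2 KV x y s -> is_inf2 KW (f x) (f y) (f s)).

Section normed.
Context {R : realType}.
Variables (V : normedModType R) (K : set V).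

Definition ordered_banach :=
  [/\ forall F : set_system V, ProperFilter F -> cauchy F -> cvg F,
      is_cone K & closed K].

Definition banach_lattice :=
  [/\ ordered_banach, vector_lattice K
    & forall x y a b, is_modulus K x a -> is_modulus K y b ->
        cone_le K a b -> `|x| <= `|y|].

Definition order_continuous_norm :=
  forall (T : Type) (le : T -> T -> Prop) (x : T -> V),
    directed le -> (forall i, K (x i)) -> increasing_net K le x ->
    order_bounded_net K x -> exists l : V, x @ net_tails le --> l.

Definition KB_space :=
  banach_lattice /\
  forall (T : Type) (le : T -> T -> Prop) (x : T -> V),
    directed le -> increasing_net K le x -> bounded_fun x ->
    exists l : V, x @ net_tails le --> l.

End normed.

Definition strong_op_cvg {R : realType} {V W : normedModType R}
    (T_ : nat -> V -> W) (T : V -> W) :=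
  forall x, T_ n x @[n --> \oo] --> T x.

Definition weak_op_cvg {R : realType} {V W : normedModType R}
    (T_ : nat -> V -> W) (T : V -> W) :=
  forall (x : V) (phi : {linear W -> R^o}), bounded_fun_norm phi ->
    phi (T_ n x) @[n --> \oo] --> phi (T x).

Definition is_norm {R : realType} {V : lmodType R} (p : V -> R) :=
  [/\ forall x y, p (x + y) <= p x + p y,
      forall (a : R) x, p (a *: x) = `|a| * p x
    & forall x, p x = 0 -> x = 0].

Definition equivalent_norms {V : Type} {R : realType} (p q : V -> R) :=
  exists c C : R, [/\ 0 < c, 0 < C & forall x, c * q x <= p x <= C * q x].

(* V with the topology of p, in place of any norm V may already carry. *)
Definition renormed {R : realType} {V : lmodType R} {p : V -> R}
  of is_norm p : Type := V.

Section renormed.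
Context {R : realType} {V : lmodType R} {p : V -> R} (hp : is_norm p).

Let pD : forall x y, p (x + y) <= p x + p y. Proof. by case: hp. Qed.
Let pZ : forall (a : R) x, p (a *: x) = `|a| * p x. Proof. by case: hp. Qed.
Let p0 : forall x, p x = 0 -> x = 0. Proof. by case: hp. Qed.

HB.instance Definition _ := GRing.Lmodule.copy (renormed hp) V.
HB.instance Definition _ :=
  @Lmodule_isNormed.Build R (renormed hp) p pD pZ p0.

Lemma renormedE (x : renormed hp) : `|x| = p x. Proof. by []. Qed.

End renormed.

Section span.
Context {R : realType} {V : lmodType R}.
Implicit Types K : set V.

Definition lin_span K : {pred V} :=
  [in smallest (fun A : set V => submod_closed [in A]) K].

Lemma lin_span_submod_closed K : submod_closed (lin_span K).
Proof.
split=> [|a x y].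
  by apply/mem_set => A [[A0 _] _]; move: A0; rewrite inE.
rewrite !inE => Kx Ky A AK; have [[_ AL] _] := AK.
by apply/set_mem/AL; apply/mem_set; [exact: Kx|exact: Ky].
Qed.

HB.instance Definition _ K :=
  GRing.isSubmodClosed.Build R V (lin_span K) (lin_span_submod_closed K).

Lemma lin_span_coneE K : is_cone K ->
  lin_span K =i [in [set x | exists y z, [/\ K y, K z & x = y - z]]].
Proof.
move=> [[k0 Kk0] KL _] x; have K0 : K 0.
  by have := KL 0 0 _ _ (lexx _) (lexx _) Kk0 Kk0; rewrite !scale0r addr0.
have KD y z : K y -> K z -> K (y + z).
  by move=> Ky Kz; have := KL 1 1 _ _ ler01 ler01 Ky Kz; rewrite !scale1r.
have KZ a y : 0 <= a -> K y -> K (a *: y).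
  by move=> a0 Ky; have := KL a 0 _ _ a0 (lexx _) Ky K0; rewrite scaler0 addr0.
apply/idP/idP; rewrite !inE.
  apply; split; last by move=> y Ky; exists y, 0; rewrite subr0.
  split=> [|a u v]; rewrite !inE; first by exists 0, 0; rewrite subr0.
  move=> [y [z [Ky Kz ->]]] [y' [z' [Ky' Kz' ->]]].
  have [a0|a0] := leP 0 a.
    exists (a *: y + y'), (a *: z + z').
    split; [exact: KD (KZ _ _ a0 Ky) Ky'|exact: KD (KZ _ _ a0 Kz) Kz'|].
    by rewrite scalerBr opprD addrACA.
  have Na0 : 0 <= - a by rewrite oppr_ge0 ltW.
  exists (- a *: z + y'), (- a *: y + z').
  split; [exact: KD (KZ _ _ Na0 Kz) Ky'|exact: KD (KZ _ _ Na0 Ky) Kz'|].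
  by rewrite scalerBr !scaleNr opprD opprK [RHS]addrACA [a *: y - _]addrC.
move=> [y [z [Ky Kz ->]]] A [[_ AL] KA]; apply/set_mem.
rewrite addrC -scaleN1r; apply: AL; apply/mem_set; [exact: KA Kz|exact: KA Ky].
Qed.

Record span_space K := SpanSpace {
  span_val :> V ;
  span_valP : span_val \in lin_span K
}.

HB.instance Definition _ K := [isSub for @span_val K].
HB.instance Definition _ K := [Choice of span_space K by <:].
HB.instance Definition _ K := [SubChoice_isSubLmodule of span_space K by <:].

Definition span_cone K : set (span_space K) := [set x | K (val x)].

End span.

Definition span_norm {R : realType} {V : normedModType R} (K : set V)
    (x : span_space K) : R :=
  inf [set r | exists y z, [/\ K y, K z, val x = y - z & r = `|y| + `|z|]].

(* Main.v *)
(** The supremum of x, y in Z_+ is a cluster point of w_n = J (R_n x \/ R_n y):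
    J R_n x <= w_n, J R_n y <= w_n, and w_n <= J R_n u for every upper bound u,
    while J R_n -> id.  Cluster points exist because S w_n is squeezed below the
    convergent sequence S J R_n (x + y), and order intervals of X are weakly compact.
    The lattice norm on span Z_+ is |S |x||, so limits of increasing nets can be
    computed in X.  For (c), if 0 <= z <= J b then R_n z <= R_n J b has a cluster
    point c, and J c = z.

    Weak compactness is used as: decreasing sequences of non-empty convex subsets of
    an order interval [0, e] have a common point in their closures.  For a positive
    functional f, the convex function y |-> sum_t f |y - t e|, with t in a fine finite
    net, is nearly minimized only on a set of small f-diameter.  Shrinking along
    suitable functionals makes the norm diameter small: otherwise some h_k in [0, e]
    with f_k (h_k) > eps would have f_j (h_k) <= 2^-k for j < k, which fails at the
    order limit superior of (h_k). *)
Require Import Defs.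
From HB Require Import structures.
From mathcomp Require Import all_boot all_order all_algebra.
From mathcomp Require Import all_classical all_reals all_analysis.
From mathcomp Require Import ring lra.

Set Implicit Arguments.
Unset Strict Implicit.
Unset Printing Implicit Defensive.

Import Order.TTheory GRing.Theory Num.Theory.
Import numFieldNormedType.Exports.

Local Open Scope classical_set_scope.
Local Open Scope ring_scope.

(* Reflective decision of equalities of linear expressions in a module: compare
   the coefficients of the atoms. *)
Inductive lexpr (R : Type) :=
  LVar of nat | LZero | LAdd of lexpr R & lexpr R | LOpp of lexpr R
| LScale of R & lexpr R.

Section lexpr.
Context {R : realType} {V : lmodType R}.
Implicit Types (e : lexpr R) (env : seq V).

Fixpoint leval env e : V :=
  match e with
  | LVar i => nth 0 env i
  | LZero => 0
  | LAdd e1 e2 => leval env e1 + leval env e2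
  | LOpp e1 => - leval env e1
  | LScale a e1 => a *: leval env e1
  end.

Fixpoint lcoef e (i : nat) : R :=
  match e with
  | LVar j => if eqn i j then 1 else 0
  | LZero => 0
  | LAdd e1 e2 => lcoef e1 i + lcoef e2 i
  | LOpp e1 => - lcoef e1 i
  | LScale a e1 => a * lcoef e1 i
  end.

Lemma leval_coef env e : leval env e = \sum_(i < size env) lcoef e i *: nth 0 env i.
Proof.
elim: e => /= [j||e1 IH1 e2 IH2|e1 IH1|a e1 IH1].
- have [jn|nj] := ltnP j (size env).
    rewrite (bigD1 (Ordinal jn)) //= eqnE eqxx scale1r big1 ?addr0// => i ij.
    by rewrite (negPf (ij : val i != j)) scale0r.
  rewrite nth_default// big1// => i _.
  rewrite eqnE; case: eqP => [ij|_]; last by rewrite scale0r.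
  by rewrite -ij leqNgt ltn_ord in nj.
- by rewrite big1// => i _; rewrite scale0r.
- by rewrite IH1 IH2 -big_split; apply: eq_bigr => i _; rewrite scalerDl.
- by rewrite IH1 -sumrN; apply: eq_bigr => i _; rewrite scaleNr.
- by rewrite IH1 scaler_sumr; apply: eq_bigr => i _; rewrite scalerA.
Qed.

Fixpoint lcoef_eq e1 e2 n : Prop :=
  if n is m.+1 then lcoef_eq e1 e2 m /\ lcoef e1 m = lcoef e2 m else True.

Lemma lexpr_eq env e1 e2 : lcoef_eq e1 e2 (size env) ->
  leval env e1 = leval env e2.
Proof.
move=> E; rewrite !leval_coef; apply: eq_bigr => i _; congr (_ *: _).
elim: (size env) E (i : nat) (ltn_ord i) => // n IH /= [En e] j.
by rewrite ltnS leq_eqVlt => /predU1P[->//|]; exact: IH.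
Qed.

End lexpr.

Ltac lmod_index x l :=
  lazymatch l with
  | x :: _ => constr:(0%N)
  | _ :: ?l' => let i := lmod_index x l' in constr:(S i)
  end.
Ltac lmod_insert x l :=
  lazymatch l with
  | context [x :: _] => l
  | _ => constr:(x :: l)
  end.
Ltac lmod_atoms t l :=
  lazymatch t with
  | 0%R => l
  | (?a + ?b)%R => let l' := lmod_atoms a l in lmod_atoms b l'
  | (- ?a)%R => lmod_atoms a l
  | (_ *: ?a)%R => lmod_atoms a l
  | _ => lmod_insert t l
  end.
Ltac lmod_reify R t l :=
  lazymatch t with
  | 0%R => constr:(@LZero R)
  | (?a + ?b)%R => let a' := lmod_reify R a l in let b' := lmod_reify R b l in
                   constr:(LAdd a' b')
  | (- ?a)%R => let a' := lmod_reify R a l in constr:(LOpp a')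
  | (?c *: ?a)%R => let a' := lmod_reify R a l in constr:(LScale c a')
  | _ => let i := lmod_index t l in constr:(@LVar R i)
  end.
Ltac lmod R :=
  lazymatch goal with
  | |- @eq ?V ?s ?t =>
    let l := lmod_atoms s (@nil V) in
    let l := lmod_atoms t l in
    let s' := lmod_reify (Real.sort R) s l in
    let t' := lmod_reify (Real.sort R) t l in
    apply: (@lexpr_eq R _ l s' t');
    cbv [lcoef_eq lcoef size eqn];
    repeat split; first [ring | field | lra]
  end.

(** * The Hahn-Banach theorem and separation *)

Section hahn_banach.
Context {R : realType} {V : lmodType R}.
Implicit Types p q : V -> R.

(* The reverse inequality p (a *: x) >= a * p x follows. *)
Definition sublinear p :=
  (forall x y, p (x + y) <= p x + p y) /\
  (forall a x, 0 <= a -> p (a *: x) <= a * p x).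

Lemma sublinear0 p : sublinear p -> p 0 = 0.
Proof.
move=> [pD pZ]; apply/le_anti/andP; split.
  by have := pZ 0 0 (lexx _); rewrite scale0r mul0r.
by have := pD 0 0; rewrite addr0; lra.
Qed.

Lemma sublinearZ p a x : sublinear p -> 0 <= a -> p (a *: x) = a * p x.
Proof.
move=> p_sub a0; have [pD pZ] := p_sub; apply/le_anti/andP; split; first exact: pZ.
have [a_gt0|a_le0] := ltP 0 a; last first.
  by have -> : a = 0 by [lra]; rewrite scale0r mul0r (sublinear0 p_sub).
have aV0 : 0 <= a^-1 by rewrite invr_ge0.
have := pZ a^-1 (a *: x) aV0.
by rewrite scalerA mulVf ?gt_eqF// scale1r ler_pdivlMl.
Qed.

Lemma sublinearN p x : sublinear p -> - p (- x) <= p x.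
Proof.
by move=> p_sub; have := p_sub.1 x (- x); rewrite subrr (sublinear0 p_sub); lra.
Qed.

(** Subadditivity survives the infimum because two competing indices can be merged into one that is
    no worse. The families used below are indexed by a ray, a chain, and the cone over a convex
    set. *)
Lemma sublinear_inf (I : Type) (P : set I) (g : I -> V -> R) :
  P !=set0 ->
  (forall x, has_lbound [set g i x | i in P]) ->
  (forall i j x y, P i -> P j -> exists2 k, P k & g k (x + y) <= g i x + g j y) ->
  (forall i a x, P i -> 0 <= a -> exists2 k, P k & g k (a *: x) <= a * g i x) ->
  sublinear (fun x => inf [set g i x | i in P]).
Proof.
move=> [i0 Pi0] glb gD gZ.
have lei i x : P i -> inf [set g i x | i in P] <= g i x.
  by move=> Pi; apply: (ge_inf (glb x)); exists i.
have ne x : [set g i x | i in P] !=set0 by exists (g i0 x), i0.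
split=> [x y|a x a0].
  rewrite -lerBlDr; apply: (lb_le_inf (ne x)) => _ [i Pi <-].
  rewrite lerBlDr -lerBlDl; apply: (lb_le_inf (ne y)) => _ [j Pj <-].
  have [k Pk kij] := gD i j x y Pi Pj.
  rewrite lerBlDl; exact: le_trans (lei _ _ Pk) kij.
have [a_gt0|a_le0] := ltP 0 a.
  rewrite -ler_pdivrMl//; apply: (lb_le_inf (ne x)) => _ [i Pi <-].
  have [k Pk ki] := gZ i a x Pi a0.
  by rewrite ler_pdivrMl//; exact: le_trans (lei _ _ Pk) ki.
have a00 : a = 0 by lra.
have [k Pk ki] := gZ i0 a x Pi0 a0.
by apply: le_trans (lei _ _ Pk) (le_trans ki _); rewrite a00 !mul0r.
Qed.

(** For fixed [y], the infimum over [t >= 0] of [q (x + t *: y) - t * q y] is sublinear in [x] and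
    at most [q x] (take [t = 0]), so minimality makes it equal to [q]; [t = 1] then gives
    [q x + q y <= q (x + y)]. *)
Lemma sublinear_minimal_linear q : sublinear q ->
  (forall r, sublinear r -> (forall x, r x <= q x) -> r = q) ->
  linear (q : V -> R^o).
Proof.
move=> q_sub q_min.
have qD x y : q (x + y) = q x + q y.
  apply/le_anti/andP; split; first exact: q_sub.1.
  pose P := [set t : R | 0 <= t].
  pose g t x := q (x + t *: y) - t * q y.
  have lb u : has_lbound [set g t u | t in P].
    exists (- q (- u)) => _ [t t0 <-]; rewrite /g -(sublinearZ _ q_sub t0).
    have := q_sub.1 (u + t *: y) (- u).
    have -> : u + t *: y - u = t *: y by lmod R.
    lra.
  have r_sub : sublinear (fun x => inf [set g t x | t in P]).
    apply: sublinear_inf => //.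
    - by exists 0; exact: lexx.
    - move=> t t' u v /= t0 t'0; exists (t + t'); first exact: addr_ge0.
      rewrite /g; have := q_sub.1 (u + t *: y) (v + t' *: y).
      have -> : u + t *: y + (v + t' *: y) = u + v + (t + t') *: y by lmod R.
      lra.
    - move=> t a u /= t0 a0; exists (a * t); first exact: mulr_ge0.
      rewrite /g; have := q_sub.2 a (u + t *: y) a0.
      have -> : a *: (u + t *: y) = a *: u + (a * t) *: y by lmod R.
      lra.
  have r_le t u : 0 <= t -> inf [set g t u | t in P] <= g t u.
    by move=> t0; apply: (ge_inf (lb u)); exists t.
  have rq : (fun x => inf [set g t x | t in P]) = q.
    apply: q_min r_sub _ => u; apply: le_trans (r_le 0 u (lexx _)) _.
    by rewrite /g scale0r addr0 mul0r subr0.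
  have := r_le 1 x ler01; rewrite (congr1 (@^~ x) rq) /g scale1r mul1r; lra.
have qN x : q (- x) = - q x.
  by have := qD x (- x); rewrite subrr (sublinear0 q_sub); lra.
move=> a x y; rewrite qD; congr (_ + _).
have [a0|a0] := leP 0 a; first exact: sublinearZ.
have Na0 : 0 <= - a by lra.
have -> : a *: x = - ((- a) *: x) by lmod R.
by rewrite qN (sublinearZ _ q_sub Na0) /GRing.scale/=; lra.
Qed.

(* Hahn-Banach in the form: minimal sublinear functionals are linear. *)
Lemma sublinear_dominates_linear p : sublinear p ->
  exists f : {linear V -> R^o}, forall x, f x <= p x.
Proof.
move=> p_sub.
pose T := {q : V -> R | sublinear q /\ forall x, q x <= p x}.
(* The order is reversed: a maximal element for Zorn is a minimal functional. *)
pose below (q r : T) := `[< forall x, sval r x <= sval q x >].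
have belowP (q r : T) : reflect (forall x, sval r x <= sval q x) (below q r).
  exact: asboolP.
have [||||[q [q_sub qp]] /= q_min] := @Zorn T below.
- by move=> q; apply/belowP.
- move=> q r s /belowP rq /belowP sr; apply/belowP => x.
  exact: le_trans (sr x) (rq x).
- move=> [q qP] [r rP] /belowP rq /belowP qr; apply: eq_exist.
  by apply/funext => x; apply/le_anti; rewrite (rq x) (qr x).
- move=> A Atot.
  have [[q0 Aq0]|/set0P/negP/negPn/eqP A0] := pselect (A !=set0); last first.
    by exists (exist _ p (conj p_sub (fun=> lexx _))) => s; rewrite A0.
  have lb x : has_lbound [set sval q x | q in A].
    exists (- p (- x)) => _ [[q [q_sub qp]] _ <-] /=.
    by apply: le_trans (sublinearN x q_sub); rewrite lerN2.
  have r_sub : sublinear (fun x => inf [set sval q x | q in A]).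
    apply: sublinear_inf => //; first by exists q0.
      move=> q r x y Aq Ar; have [/belowP rq|/belowP qr] := Atot q r Aq Ar.
        exists r => //; apply: le_trans ((svalP r).1.1 x y) _.
        by rewrite lerD2r.
      exists q => //; apply: le_trans ((svalP q).1.1 x y) _.
      by rewrite lerD2l.
    by move=> q a x Aq a0; exists q => //; exact: (svalP q).1.2.
  have r_le (q : T) x : A q -> inf [set sval q x | q in A] <= sval q x.
    by move=> Aq; apply: (ge_inf (lb x)); exists q.
  have rp x : inf [set sval q x | q in A] <= p x.
    exact: le_trans (r_le _ _ Aq0) ((svalP q0).2 x).
  have rT : sublinear (fun x => inf [set sval q x | q in A]) /\
      forall x, inf [set sval q x | q in A] <= p x by [].
  exists (exist (fun q => sublinear q /\ forall x, q x <= p x) _ rT) => q Aq.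
  by apply/belowP => x; exact: r_le.
have q_lin : linear (q : V -> R^o).
  apply: sublinear_minimal_linear => // r r_sub rq.
  have rp x : r x <= p x by exact: le_trans (rq x) (qp x).
  have /(_ _)/(congr1 sval)/= -> // := q_min (exist _ r (conj r_sub rp)).
  exact/belowP.
pose f : {linear V -> R^o} :=
  HB.pack (q : V -> R^o) (GRing.isLinear.Build _ _ _ _ _ q_lin).
by exists f.
Qed.

End hahn_banach.

Lemma functionalZ {R : realType} {V : lmodType R} (f : {linear V -> R^o}) a x :
  f (a *: x) = a * f x.
Proof. by rewrite linearZ. Qed.

Definition is_convex {R : realType} {V : lmodType R} (C : set V) :=
  forall (a b : R) x y, 0 <= a -> 0 <= b -> a + b = 1 -> C x -> C y ->
    C (a *: x + b *: y).

(** The dominating functional is the infimum of [|x + t c| - t d] over [t >= 0] and [c] in [C],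
    bounded below by [-|x|] because [d <= |c|]. Taking [t = 0] bounds [f] by the norm; taking
    [t = 1] at [x = - c] gives [f (- c) <= - d]. *)
Lemma convex_separation {R : realType} {V : normedModType R} (C : set V) (d : R) :
  C !=set0 -> is_convex C -> (forall c, C c -> d <= `|c|) ->
  exists f : {linear V -> R^o},
    (forall x, `|f x| <= `|x|) /\ (forall c, C c -> d <= f c).
Proof.
move=> [c0 Cc0] Ccvx Cd.
pose P := [set tc : R * V | 0 <= tc.1 /\ C tc.2].
pose g (tc : R * V) x := `|x + tc.1 *: tc.2| - tc.1 * d.
have lb x : has_lbound [set g tc x | tc in P].
  exists (- `|x|) => _ [[t c] [/= t0 Cc] <-]; rewrite /g/=.
  have := ler_normB (x + t *: c) x.
  have -> : x + t *: c - x = t *: c by lmod R.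
  rewrite normrZ (ger0_norm t0); have := ler_wpM2l t0 (Cd _ Cc); rewrite /=; lra.
have p_sub : sublinear (fun x => inf [set g tc x | tc in P]).
  apply: sublinear_inf => //; first by exists (0, c0).
    move=> [t c] [t' c'] x y /= [/= t0 Cc] [/= t'0 Cc'].
    have [tt'|tt'] := ltP 0 (t + t'); last first.
      have -> : t = 0 by lra.
      have -> : t' = 0 by lra.
      exists (0, c0) => //=; rewrite /g/= !scale0r !addr0 !mul0r !subr0.
      exact: ler_normD.
    have tt'0 : t + t' != 0 by rewrite gt_eqF.
    exists (t + t', (t / (t + t')) *: c + (t' / (t + t')) *: c') => /=.
      split; first by rewrite /= ltW.
      apply: Ccvx => //; rewrite ?divr_ge0// ?ltW//.
      by rewrite -mulrDl divff.
    rewrite /g/=; set w := (X in `|X| - _ <= _).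
    have -> : w = (x + t *: c) + (y + t' *: c') by rewrite /w; lmod R.
    by have := ler_normD (x + t *: c) (y + t' *: c'); lra.
  move=> [t c] a x /= [/= t0 Cc] a0; exists (a * t, c) => /=.
    by split=> //=; rewrite mulr_ge0.
  rewrite /g/=; have -> : a *: x + (a * t) *: c = a *: (x + t *: c) by lmod R.
  by rewrite normrZ (ger0_norm a0); lra.
have [f fp] := sublinear_dominates_linear p_sub.
have p_le tc x : P tc -> inf [set g tc x | tc in P] <= g tc x.
  by move=> Ptc; apply: (ge_inf (lb x)); exists tc.
have fn x : f x <= `|x|.
  have := le_trans (fp x) (p_le (0, c0) x (conj (lexx 0) Cc0)).
  by rewrite /g/= scale0r addr0 mul0r subr0.
exists f; split=> [x|c Cc].
  rewrite ler_norml fn andbT; have := fn (- x); rewrite linearN normrN; lra.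
have := le_trans (fp (- c)) (p_le (1, c) (- c) (conj ler01 Cc)).
rewrite /g/= scale1r addNr normr0 linearN mul1r sub0r; lra.
Qed.

(** * Bounded inverses *)

Lemma norm_small_eq0 {R : realType} {V : normedModType R} (x : V) :
  (forall e : R, 0 < e -> `|x| <= e) -> x = 0.
Proof.
move=> xe; apply/eqP; rewrite -normr_le0; apply/ler_addgt0Pr => e e0.
by rewrite add0r; exact: xe.
Qed.

Lemma seq_cvgP {R : realType} {V : normedModType R} (u : nat -> V) (l : V) :
  u n @[n --> \oo] --> l <->
  forall e : R, 0 < e -> exists N, forall n, (N <= n)%N -> `|u n - l| <= e.
Proof.
rewrite cvgrPdistC_le; split=> ul e e0.
  by have [N _ uN] := ul e e0; exists N => n /uN.
by have [N uN] := ul e e0; exists N.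
Qed.

Lemma net_cvgP {R : realType} {V : normedModType R} (T : Type)
    (le : T -> T -> Prop) (x : T -> V) (l : V) :
  x @ net_tails le --> l <->
  forall e : R, 0 < e -> exists i, forall j, le i j -> `|x j - l| < e.
Proof.
split=> [xl e e0|xl A /nbhs_ballP[e e0 eA]].
  have [i xi] := xl _ (nbhsx_ballx l e e0).
  by exists i => j /xi; rewrite -ball_normE /= distrC.
have [i xi] := xl e e0; exists i => j ij; apply: eA.
by rewrite -ball_normE /= distrC; exact: xi.
Qed.

Lemma half_pow_small {R : realType} (C e : R) : 0 < e ->
  exists n, C * 2^-1 ^+ n <= e.
Proof.
move=> e0; have C0 : 0 < `|C| + 1 by have := normr_ge0 C; lra.
have /seq_cvgP/(_ (e / (`|C| + 1)) (divr_gt0 e0 C0))[n /(_ n (leqnn _))] :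
    (fun n => (2^-1 : R^o) ^+ n) n @[n --> \oo] --> (0 : R^o).
  by apply: cvg_expr; rewrite ger0_norm; lra.
rewrite subr0 => le; exists n.
have En : 0 <= 2^-1 ^+ n :> R by apply: exprn_ge0; lra.
rewrite ger0_norm // ler_pdivlMr// mulrC in le.
have := ler_wpM2r En (ler_norm C); lra.
Qed.

Lemma geometric_cvg {R : realType} {V : completeNormedModType R} (u : nat -> V)
    (C : R) : (forall n, `|u n.+1 - u n| <= C * 2^-1 ^+ n) ->
  exists l, forall n, `|u n - l| <= 2 * C * 2^-1 ^+ n.
Proof.
move=> uC; have C0 : 0 <= C.
  by have := le_trans (normr_ge0 _) (uC 0%N); rewrite expr0; lra.
have E n : 0 <= 2^-1 ^+ n :> R by rewrite exprn_ge0; lra.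
(* Writing the geometric sum as a difference lets the induction on [m] close. *)
have u_le n m : (n <= m)%N ->
    `|u m - u n| <= 2 * C * 2^-1 ^+ n - 2 * C * 2^-1 ^+ m.
  elim: m => [|m IH]; first by rewrite leqn0 => /eqP->; rewrite !subrr normr0.
  rewrite leq_eqVlt => /predU1P[->|/IH nm]; first by rewrite !subrr normr0.
  apply: le_trans (ler_distD (u m) _ _) _.
  by have := uC m; rewrite exprS; lra.
have u_dist n m : (n <= m)%N -> `|u n - u m| <= 2 * C * 2^-1 ^+ n.
  by move=> /u_le; rewrite distrC; have := mulr_ge0 C0 (E m); lra.
have : cauchy (u @ \oo).
  apply/cauchy_ballP => e e0.
  (* The summand [1] makes the final estimate strict, as open balls require. *)
  have [n nC] := half_pow_small (2 * (2 * C) + 1) e0.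
  have En : 0 < 2^-1 ^+ n :> R by rewrite exprn_gt0; lra.
  exists ([set x | `|u n - x| <= 2 * C * 2^-1 ^+ n],
          [set x | `|u n - x| <= 2 * C * 2^-1 ^+ n]) => /=.
    by split; exists n => // m /u_dist.
  move=> [x y] [/= nx ny]; rewrite -ball_normE /=.
  rewrite distrC in nx.
  by have := ler_distD (u n) x y; lra.
move=> /cauchy_cvg ul; exists (lim (u @ \oo)) => n.
apply/ler_addgt0Pr => e e0.
have /seq_cvgP/(_ e e0)[N uN] := ul.
have := uN _ (leq_maxl N n); have := u_dist _ _ (leq_maxr N n).
by have := ler_distD (u (maxn N n)) (u n) (lim (u @ \oo)); lra.
Qed.

Lemma bounded_norm_le {R : realType} {V W : normedModType R} (f : {linear V -> W}) :
  bounded_fun_norm f -> exists2 C, 0 < C & forall x, `|f x| <= C * `|x|.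
Proof.
move=> /(_ 1)[M fM]; exists (`|M| + 1); first by have := normr_ge0 M; lra.
move=> x; have [->|x0] := eqVneq x 0; first by rewrite linear0 !normr0 mulr0.
have x_gt0 : 0 < `|x| by rewrite normr_gt0.
have := fM (`|x|^-1 *: x); rewrite linearZ !normrZ normfV normr_id mulVf ?gt_eqF//.
move=> /(_ (lexx _)); rewrite ler_pdivrMl// mulrC => /le_trans; apply.
by rewrite ler_wpM2r// ?ltW//; have := ler_norm M; lra.
Qed.

Lemma norm_le_bounded {R : realType} {V W : normedModType R} (f : V -> W) (C : R) :
  (forall x, `|f x| <= C * `|x|) -> bounded_fun_norm f.
Proof.
move=> fC r; exists (`|C| * r) => x xr; apply: le_trans (fC x) _.
apply: le_trans (ler_wpM2r (normr_ge0 _) (ler_norm C)) _.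
exact: ler_wpM2l.
Qed.

(* By uniform boundedness the functionals f with |f x| <= |S^-1 x| are bounded by a
   common M; separation then makes every x approximable by S z with |z| <= M |x|. *)
Lemma linear_bijection_approx {R : realType} {Z X : completeNormedModType R}
    (S : {linear Z -> X}) : bijective S ->
  exists2 M : R, 0 < M & forall x (e : R), 0 < e ->
    exists2 z : Z, `|z| <= M * `|x| & `|x - S z| <= e.
Proof.
move=> [T TS ST].
pose F : set (X -> R^o) := [set f | (bounded_fun_norm f /\ linear f) /\
  forall x, `|f x| <= `|T x|].
have [f [] //| x |M0 FM] := @Banach_Steinhauss R X R^o F _ _ 1.
  by exists `|T x| => f [_ /(_ x)].
have FM' f x : F f -> `|f x| <= `|M0| * `|x|.
  move=> Ff; have [[_ flin] _] := Ff.
  pose f' : {linear X -> R^o} :=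
    HB.pack f (GRing.isLinear.Build _ _ _ _ _ flin).
  have [->|x0] := eqVneq x 0.
    have f0 : f 0 = 0 := linear0 f'.
    by rewrite f0 !normr0 mulr0.
  have x_gt0 : 0 < `|x| by rewrite normr_gt0.
  have fZ a : f (a *: x) = a *: f x := linearZ_LR f' a x.
  have := FM f Ff (`|x|^-1 *: x).
  rewrite fZ normrZ normfV normr_id mulVf ?gt_eqF//.
  move=> /(_ (lexx _)); rewrite normrZ normfV normr_id ler_pdivrMl// mulrC.
  by move=> /le_trans; apply; rewrite ler_wpM2r// ler_norm.
exists (`|M0| + 1) => [|x e e0]; first by have := normr_ge0 M0; lra.
pose M : R := `|M0| + 1; have M_gt0 : 0 < M by rewrite /M; have := normr_ge0 M0; lra.
have [->|x0] := eqVneq x 0.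
  exists 0; first by rewrite !normr0 mulr0.
  by rewrite (linear0 S) subr0 normr0 ltW.
have x_gt0 : 0 < `|x| by rewrite normr_gt0.
have [rho rhoE] : exists rho : R, rho = M * `|x| by exists (M * `|x|).
 have rho0 : 0 < rho by rewrite rhoE mulr_gt0.
(* Otherwise the convex set of residuals [x - S z], [|z| <= rho], keeps distance [e] from 0. A
   suitable multiple of a separating [f] then belongs to [F] but is too large at [x]. *)
apply: contrapT => no.
pose C := [set x - S z | z in [set z | `|z| <= rho]].
have [|||f [f1 fC]] := @convex_separation R X C e.
- by exists (x - S 0), 0 => //=; rewrite normr0 ltW.
- move=> a b _ _ a0 b0 ab [z /= zr <-] [w /= wr <-].
  exists (a *: z + b *: w) => /=.
    apply: le_trans (ler_normD _ _) _; rewrite !normrZ !ger0_norm//.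
    have := ler_wpM2l a0 zr; have := ler_wpM2l b0 wr.
    have -> : b = 1 - a by [lra].
    lra.
  have -> : b = 1 - a by [lra].
  by rewrite linearD !linearZ /=; lmod R.
- move=> _ [z /= zr <-]; rewrite leNgt; apply/negP => lt.
  by apply: no; exists z; [rewrite -rhoE|exact: ltW].
have [v vE] : exists v : R, v = f x by exists (f x).
(* The separation inequality is applied to [z] rescaled to norm [rho]. *)
have fS z : rho * f (S z) <= (v - e) * `|z|.
  have [->|z0] := eqVneq z 0; first by rewrite !linear0 normr0 !mulr0.
  have z_gt0 : 0 < `|z| by rewrite normr_gt0.
  have zC : C (x - (rho / `|z|) *: S z).
    exists ((rho / `|z|) *: z); last by rewrite linearZ.
    have q0 : 0 <= rho / `|z| by rewrite divr_ge0// ltW.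
    by rewrite /= normrZ (ger0_norm q0) divfK ?gt_eqF.
  have h : e <= v - rho / `|z| * f (S z).
    by have := fC _ zC; rewrite linearB linearZ vE.
  rewrite mulrAC in h.
  have : rho * f (S z) / `|z| <= v - e by lra.
  by rewrite ler_pdivrMr.
have fx : e <= v.
  have := fC _ (ex_intro2 _ _ 0 _ erefl); rewrite linear0 subr0 vE; apply.
  by rewrite /= normr0 ltW.
have absfS z : rho * `|f (S z)| <= (v - e) * `|z|.
  have := fS z; have := fS (- z); rewrite normrN !linearN.
  by case: (ger0P (f (S z))); lra.
(* If [v = e], then [absfS] forces [f] to vanish on the range of [S], hence at [x], although
   [f x = e > 0]. *)
have fxe : e < v.
  rewrite lt_neqAle fx andbT; apply/eqP => fxE.
  have := absfS (T x); rewrite ST -fxE subrr mul0r pmulr_rle0// -vE -fxE.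
  by rewrite normr_le0 gt_eqF.
have g_lin : linear ((fun y => rho / (v - e) * f y) : X -> R^o).
  by move=> a y1 y2; rewrite linearP /GRing.scale/=; ring.
have Fg : F ((fun y => rho / (v - e) * f y) : X -> R^o).
  split; last first.
    move=> y; rewrite normrM ger0_norm ?divr_ge0 ?subr_ge0 ?(ltW rho0)//.
    rewrite mulrAC ler_pdivrMr ?subr_gt0// mulrC [leRHS]mulrC.
    by rewrite mulrC; have := absfS (T y); rewrite ST.
  split=> //; apply: (@norm_le_bounded _ _ _ _ (rho / (v - e))) => y.
  rewrite normrM ger0_norm ?divr_ge0 ?subr_ge0 ?(ltW rho0)//.
  by rewrite ler_wpM2l ?divr_ge0 ?subr_ge0 ?(ltW rho0).
have := FM' _ x Fg; rewrite -vE ger0_norm; last first.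
  by rewrite mulr_ge0 ?divr_ge0 ?subr_ge0 ?(ltW rho0)// (le_trans _ fx) ?ltW.
rewrite mulrAC ler_pdivrMr ?subr_gt0// => h.
have : rho * v <= rho * (v - e).
  apply: le_trans h _; rewrite ler_wpM2r ?subr_ge0//.
  by rewrite rhoE ler_wpM2r ?(ltW x_gt0)// /M; lra.
by rewrite ler_pM2l//; lra.
Qed.

(** The iteration of the open mapping theorem: the residual of [S z] is approximated again and again
    with halved tolerance. The corrections form a geometric series of total norm at most
    [2 * M * |S z|], and injectivity identifies its sum with [z]. *)
Lemma linear_bijection_inverse_bounded {R : realType}
    {Z X : completeNormedModType R} (S : {linear Z -> X}) :
  bounded_fun_norm S -> bijective S ->
  exists2 C : R, 0 < C & forall z, `|z| <= C * `|S z|.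
Proof.
move=> S_bnd S_bij.
have [M M0 SM] := linear_bijection_approx S_bij.
have [B B0 SB] := bounded_norm_le S_bnd.
exists (2 * M) => [|z]; first by lra.
have [Sz0|Sz0] := eqVneq (S z) 0.
  have -> : z = 0 by apply: (bij_inj S_bij); rewrite Sz0 linear0.
  by rewrite linear0 !normr0 mulr0.
have Sz_gt0 : 0 < `|S z| by rewrite normr_gt0.
pose e n : R := `|S z| * 2^-1 ^+ n.
have e_gt0 n : 0 < e n by rewrite mulr_gt0// exprn_gt0; lra.
(* The stage is stored in the state because the tolerance depends on it. The invariant is a premise,
   so that the step is defined for every state. *)
have step (nu : nat * Z) : {mv : nat * Z | mv.1 = nu.1.+1 /\
    (`|S z - S nu.2| <= e nu.1 ->
     `|S z - S mv.2| <= e mv.1 /\ `|mv.2 - nu.2| <= M * e nu.1)}.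
  apply: cid; have [w w_le Sw] := SM (S z - S nu.2) _ (e_gt0 nu.1.+1).
  exists (nu.1.+1, nu.2 + w); split=> //= zu; split.
    by rewrite linearD opprD addrA.
  have -> : nu.2 + w - nu.2 = w by lmod R.
  by apply: le_trans w_le _; rewrite ler_wpM2l// ltW.
have [u [u0 uS]] := dependent_choice step (0%N, 0).
have u1 n : (u n).1 = n.
  by elim: n => [|n IH]; [rewrite u0|rewrite (uS n).1 IH].
have uz n : `|S z - S (u n).2| <= e n.
  elim: n => [|n IH]; first by rewrite u0 linear0 subr0 /e expr0 mulr1.
  by have := (uS n).2; rewrite !u1 => /(_ IH)[].
have uu n : `|(u n.+1).2 - (u n).2| <= M * `|S z| * 2^-1 ^+ n.
  by have := (uS n).2; rewrite !u1 => /(_ (uz n))[_]; rewrite /e mulrA.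
have [l ul] := geometric_cvg uu.
have zl : z = l.
  apply: (bij_inj S_bij); apply/eqP; rewrite -subr_eq0; apply/eqP.
  apply: norm_small_eq0 => d d0.
  have [n nd] := half_pow_small (`|S z| + B * (2 * (M * `|S z|))) d0.
  have := SB ((u n).2 - l); rewrite linearB.
  have := ler_wpM2l (ltW B0) (ul n).
  have := ler_distD (S (u n).2) (S z) (S l); have := uz n; rewrite /e; lra.
by have := ul 0%N; rewrite u0 expr0 -zl sub0r normrN; lra.
Qed.

(** * Vector lattice calculus *)

Section cone_order.
Context {R : realType} {V : lmodType R} {K : set V}.
Hypothesis HK : is_cone K.
Local Notation "x <=v y" := (cone_le K x y) (at level 70).

Lemma coneD u v : K u -> K v -> K (u + v).
Proof.
have [_ KL _] := HK => Ku Kv.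
by have := KL 1 1 _ _ ler01 ler01 Ku Kv; rewrite !scale1r.
Qed.

Lemma cone0 : K 0.
Proof.
have [[k Kk] KL _] := HK.
by have := KL 0 0 _ _ (lexx _) (lexx _) Kk Kk; rewrite !scale0r addr0.
Qed.

Lemma coneZ a u : 0 <= a -> K u -> K (a *: u).
Proof.
have [_ KL _] := HK => a0 Ku.
by have := KL a 0 _ _ a0 (lexx _) Ku Ku; rewrite scale0r addr0.
Qed.

Lemma cone_anti u : K u -> K (- u) -> u = 0.
Proof.
have [_ _ KN] := HK => Ku KNu.
suff : [set 0] u by [].
by rewrite -KN; split => //; exists (- u); rewrite ?opprK.
Qed.

Lemma cone_eq u v : K u -> u = v -> K v. Proof. by move=> Ku <-. Qed.
Local Notation ceq := (@cone_eq _ _).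

Lemma cle_refl x : x <=v x.
Proof. by rewrite /cone_le subrr; exact: cone0. Qed.

Lemma cle_trans y x z : x <=v y -> y <=v z -> x <=v z.
Proof. by move=> xy yz; apply: (ceq (coneD xy yz)); lmod R. Qed.

Lemma cle_anti x y : x <=v y -> y <=v x -> x = y.
Proof.
move=> xy yx; apply/eqP; rewrite -subr_eq0; apply/eqP; apply: cone_anti => //.
by apply: (ceq xy); lmod R.
Qed.

Lemma cleD x x' y y' : x <=v y -> x' <=v y' -> x + x' <=v y + y'.
Proof. by move=> xy xy'; apply: (ceq (coneD xy xy')); lmod R. Qed.

Lemma cleN x y : x <=v y -> - y <=v - x.
Proof. by move=> xy; apply: (ceq xy); lmod R. Qed.

Lemma cleZ a x y : 0 <= a -> x <=v y -> a *: x <=v a *: y.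
Proof. by move=> a0 xy; apply: (ceq (coneZ a0 xy)); lmod R. Qed.

Lemma cle0 x : 0 <=v x <-> K x.
Proof. by rewrite /cone_le subr0. Qed.

Lemma is_sup2_unique x y s t : is_sup2 K x y s -> is_sup2 K x y t -> s = t.
Proof. by move=> [xs ys sl] [xt yt tl]; apply: cle_anti; [exact: sl|exact: tl]. Qed.

Lemma is_sup2_shift x y s z : is_sup2 K x y s -> is_sup2 K (x + z) (y + z) (s + z).
Proof.
move=> [xs ys sl]; split; [exact: cleD xs (cle_refl _)|exact: cleD ys (cle_refl _)|].
move=> u xu yu; apply: (ceq (sl (u - z) _ _)); last by lmod R.
  by apply: (ceq xu); lmod R.
by apply: (ceq yu); lmod R.
Qed.

Lemma is_inf2_sup2N x y s : is_inf2 K x y s <-> is_sup2 K (- x) (- y) (- s).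
Proof.
split=> -[sx sy sl].
  split; [exact: cleN|exact: cleN|move=> u xu yu].
  rewrite -(opprK u); apply: cleN; apply: sl.
    by have := cleN xu; rewrite opprK.
  by have := cleN yu; rewrite opprK.
split.
- by have := cleN sx; rewrite !opprK.
- by have := cleN sy; rewrite !opprK.
- by move=> u /cleN ux /cleN uy; have /cleN := sl _ ux uy; rewrite !opprK.
Qed.

End cone_order.

(** * Supremum, modulus and positive part as operations *)

Section riesz.
Context {R : realType} {V : lmodType R}.

(** A total operation obtained by choice; [0] is the default where no supremum exists. *)
Definition vsup (K : set V) x y := xget 0 [set s | is_sup2 K x y s].
Definition vabs K x := vsup K x (- x).
Definition vpos K x := vsup K x 0.

Context {K : set V}.
Hypotheses (HK : is_cone K) (HL : vector_lattice K).
Local Notation "x <=v y" := (cone_le K x y) (at level 70).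
Local Notation "<| x |>" := (vabs K x) (format "<| x |>").
Local Notation ceq := (@cone_eq _ _ K _ _).
Local Notation "x ^p" := (vpos K x) (at level 2, format "x ^p").

Lemma vsupP x y : is_sup2 K x y (vsup K x y).
Proof.
by have [s xys] := HL x y; apply: (xgetPex 0 (P := is_sup2 K x y)); exists s.
Qed.

Lemma vsupE x y s : is_sup2 K x y s -> vsup K x y = s.
Proof. exact: (is_sup2_unique HK (vsupP x y)). Qed.

Lemma vsup_ge1 x y : x <=v vsup K x y. Proof. by have [] := vsupP x y. Qed.
Lemma vsup_ge2 x y : y <=v vsup K x y. Proof. by have [] := vsupP x y. Qed.
Lemma vsup_le x y u : x <=v u -> y <=v u -> vsup K x y <=v u.
Proof. by have [_ _] := vsupP x y; apply. Qed.

(* Distributivity, as a principle of proof by cases. *)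
Lemma cle_vsup_cases w a b s : w <=v vsup K a b ->
  (forall z, z <=v w -> z <=v a -> z <=v s) ->
  (forall z, z <=v w -> z <=v b -> z <=v s) -> w <=v s.
Proof.
move=> wab sa sb.
have le c : c <=v vsup K a b -> (forall z, z <=v w -> z <=v c -> z <=v s) ->
    c <=v s + vsup K a b - w.
  move=> cab sc.
  (* [w + c - vsup K w c] is the infimum of [w] and [c]. *)
  have H : w + c - vsup K w c <=v s.
    apply: sc; first by apply: (ceq (vsup_ge2 w c)); lmod R.
    by apply: (ceq (vsup_ge1 w c)); lmod R.
  by apply: (ceq (coneD HK H (vsup_le wab cab))); lmod R.
have H := vsup_le (le _ (vsup_ge1 a b) sa) (le _ (vsup_ge2 a b) sb).
by apply: (ceq H); lmod R.
Qed.

Lemma vabs_ge x : x <=v <|x|>. Proof. exact: vsup_ge1. Qed.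
Lemma vabs_geN x : - x <=v <|x|>. Proof. exact: vsup_ge2. Qed.
Lemma vabs_le x u : x <=v u -> - x <=v u -> <|x|> <=v u. Proof. exact: vsup_le. Qed.

Lemma vabs_pos x : K <|x|>.
Proof.
have h : 0 <= 2^-1 :> R by lra.
by apply: (ceq (coneZ HK h (coneD HK (vabs_ge x) (vabs_geN x)))); lmod R.
Qed.

Lemma vabs_id x : K x -> <|x|> = x.
Proof.
move=> Kx; apply: (vsupE (y := - x)); split => //; first exact: cle_refl.
by apply: (ceq (coneD HK Kx Kx)); lmod R.
Qed.

Lemma vabs0 : <|0|> = 0. Proof. by rewrite vabs_id//; exact: cone0. Qed.

Lemma vabs_eq0 x : <|x|> = 0 -> x = 0.
Proof.
move=> x0; apply: (cone_anti HK).
  by have := vabs_geN x; rewrite x0 /cone_le sub0r opprK.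
by have := vabs_ge x; rewrite x0 /cone_le sub0r.
Qed.

Lemma vabsN x : <|- x|> = <|x|>.
Proof.
apply: (cle_anti HK).
  by apply: vabs_le; rewrite ?opprK; [exact: vabs_geN|exact: vabs_ge].
by apply: vabs_le; [rewrite -{1}(opprK x)|]; [exact: vabs_geN|exact: vabs_ge].
Qed.

Lemma vabsD x y : <|x + y|> <=v <|x|> + <|y|>.
Proof.
apply: vabs_le; first exact: (cleD HK (vabs_ge x) (vabs_ge y)).
by rewrite opprD; exact: (cleD HK (vabs_geN x) (vabs_geN y)).
Qed.

Lemma vabsZ a x : <|a *: x|> = Num.norm a *: <|x|>.
Proof.
have pos b y : 0 < b -> <|b *: y|> = b *: <|y|>.
  move=> b0; apply: vsupE; split.
  - by apply: cleZ => //; [exact: ltW|exact: vabs_ge].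
  - by rewrite -scalerN; apply: cleZ => //; [exact: ltW|exact: vabs_geN].
  move=> u yu Nyu; have bV0 : 0 <= b^-1 by rewrite invr_ge0 ltW.
  have b_n0 : b != 0 by rewrite gt_eqF.
  have H : <|y|> <=v b^-1 *: u.
    by apply: vabs_le; [apply: (ceq (coneZ HK bV0 yu))|
      apply: (ceq (coneZ HK bV0 Nyu))]; lmod R.
  by apply: (ceq (coneZ HK (ltW b0) H)); lmod R.
have [a0|a0|->] := ltrgt0P a.
- exact: pos.
- have -> : a *: x = - ((- a) *: x) by lmod R.
  by rewrite vabsN pos// oppr_gt0.
- by rewrite !scale0r vabs0.
Qed.

Lemma vpos_pos x : K x^p.
Proof. by apply/cle0; exact: vsup_ge2. Qed.
Lemma vpos_ge x : x <=v x^p. Proof. exact: vsup_ge1. Qed.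
Lemma vpos_le x u : x <=v u -> K u -> x^p <=v u.
Proof. by move=> xu Ku; apply: vsup_le => //; apply/cle0. Qed.

Lemma vposBN x : x = x^p - (- x)^p.
Proof.
have le : (- x)^p <=v x^p - x.
  by apply: vpos_le; [apply: (ceq (vpos_pos x)); lmod R|exact: vpos_ge].
have ge : x^p <=v x + (- x)^p.
  apply: vpos_le; first by apply: (ceq (vpos_pos (- x))); lmod R.
  by apply: (ceq (vpos_ge (- x))); lmod R.
apply: (cle_anti HK); first by apply: (ceq le); lmod R.
by apply: (ceq ge); lmod R.
Qed.

Lemma vpos_le_abs x : x^p <=v <|x|>.
Proof. by apply: vpos_le; [exact: vabs_ge|exact: vabs_pos]. Qed.

Lemma vabs_convex_gap m d : K (<|m + d|> + <|m - d|> - 2 *: <|m|>).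
Proof.
have -> : 2 *: <|m|> = <|2 *: m|> by rewrite vabsZ ger0_norm.
have -> : 2 *: m = m + d + (m - d) by lmod R.
exact: vabsD.
Qed.

(** Quantitative convexity of the modulus: the second difference is positive and, as
    [2 |d| <= |m + d| + |m - d|], also dominates [2 (|d| - |m|)]. Thus two points with almost no gap
    at their midpoint [m] differ little wherever [|m|] is small. *)
Lemma vabs_convex_gap_ge m d :
  2 *: (<|d|> - <|m|>)^p <=v <|m + d|> + <|m - d|> - 2 *: <|m|>.
Proof.
have le : <|d|> - <|m|> <=v 2^-1 *: (<|m + d|> + <|m - d|> - 2 *: <|m|>).
  have h : 0 <= 2^-1 :> R by lra.
  have H := vabsD (m + d) (- (m - d)).
  have E : <|m + d - (m - d)|> = 2 *: <|d|>.
    have -> : m + d - (m - d) = 2 *: d by lmod R.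
    by rewrite vabsZ ger0_norm.
  rewrite E vabsN in H.
  by apply: (ceq (coneZ HK h H)); lmod R.
have pos := vabs_convex_gap m d.
have h : 0 <= 2^-1 :> R by lra.
have h2 : 0 <= 2 :> R by lra.
apply: (ceq (coneZ HK h2 (vpos_le le (coneZ HK h pos)))).
by lmod R.
Qed.

(* [||m| - v|] is at least the infimum of [|m - v|] and [|m + v|]. *)
Lemma vpos_abs_split p m v :
  (p - <| <|m|> - v |>)^p <=v (p - <|m - v|>)^p + (p - <|m + v|>)^p.
Proof.
set P := (p - <|m - v|>)^p; set Q := (p - <|m + v|>)^p; set A := <| <|m|> - v |>.
have KP : K P := vpos_pos _.
have KQ : K Q := vpos_pos _.
have P1 : p - <|m - v|> <=v P := vpos_ge _.
have Q1 : p - <|m + v|> <=v Q := vpos_ge _.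
apply: vpos_le; last exact: coneD.
suff H : p - P - Q <=v A by apply: (ceq H); lmod R.
have wP : p - P - Q <=v <|m - v|>.
  by apply: (ceq (coneD HK KQ P1)); lmod R.
have wQ : p - P - Q <=v <|m + v|>.
  by apply: (ceq (coneD HK KP Q1)); lmod R.
have A1 : <|m|> - v <=v A := vabs_ge _.
have A2 : - (<|m|> - v) <=v A := vabs_geN _.
apply: (cle_vsup_cases wP) => z zw zmv.
  apply: (cle_trans HK zmv); apply: (cle_trans HK _ A1).
  by apply: (ceq (vabs_ge m)); lmod R.
(* In this case [t <= v - m]; together with [t <= m + v] it yields [t <= v - |m|]. *)
apply: (cle_vsup_cases (cle_trans HK zw wQ)) => t tz tmv.
  apply: (cle_trans HK _ A2).
  have H : <|m|> <=v v - t.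
    apply: vabs_le; first by apply: (ceq (cle_trans HK tz zmv)); lmod R.
    by apply: (ceq tmv); lmod R.
  by apply: (ceq H); lmod R.
apply: (cle_trans HK tmv); apply: (cle_trans HK _ A1).
by apply: (ceq (vabs_geN m)); lmod R.
Qed.

(* A finite set of multiples of e that is 2^-k-dense, relative to e, near m. *)
Lemma dyadic_net (e : V) k (lam : R) : 0 <= lam -> exists T : seq R,
  forall m p, <|m|> <=v lam *: e -> K p ->
    p <=v \sum_(t <- T) (p - <|m - t *: e|>)^p + (lam * 2^-1 ^+ k) *: e.
Proof.
elim: k lam => [|k IH] lam lam0.
  exists [:: 0] => m p me Kp; rewrite big_seq1 expr0 mulr1 scale0r subr0.
  by apply: (ceq (coneD HK me (vpos_ge (p - <|m|>)))); lmod R.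
have [|T HT] := IH (lam / 2); first by lra.
(* Folding [m] to [|m| - (lam / 2) e] halves the range. A point [t] of the net for the folded
   element unfolds to the two points [t + lam / 2] and [- (t + lam / 2)]. *)
exists ([seq t + lam / 2 | t <- T] ++ [seq - (t + lam / 2) | t <- T]) => m p me Kp.
rewrite big_cat !big_map /=.
have mu : <| <|m|> - (lam / 2) *: e |> <=v (lam / 2) *: e.
  apply: vabs_le; first by apply: (ceq me); lmod R.
  by apply: (ceq (vabs_pos m)); lmod R.
have H := HT _ p mu Kp.
have -> : lam * 2^-1 ^+ k.+1 = lam / 2 * 2^-1 ^+ k by rewrite exprS mulrA.
apply: (cle_trans HK H); apply: (cleD HK _ (cle_refl HK _)).
elim: T {HT H} => [|t T IHT].
  by rewrite !big_nil addr0; exact: cle_refl.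
rewrite !big_cons; have H := vpos_abs_split p m ((t + lam / 2) *: e).
have -> : <|m|> - (lam / 2) *: e - t *: e = <|m|> - (t + lam / 2) *: e by lmod R.
have -> : m - - (t + lam / 2) *: e = m + (t + lam / 2) *: e by lmod R.
by rewrite addrACA; exact: (cleD HK H IHT).
Qed.

End riesz.

Lemma closed_approx {R : realType} {V : normedModType R} (A : set V) x :
  closed A -> (forall e : R, 0 < e -> exists2 a, A a & `|a - x| <= e) -> A x.
Proof.
move=> Acl Ax; apply: Acl => U /nbhs_ballP[e e0 eU].
have [|a Aa ax] := Ax (e / 2); first by rewrite divr_gt0.
exists a; split => //; apply: eU; rewrite -ball_normE /= distrC.
by apply: le_lt_trans ax _; rewrite /= in e0; lra.
Qed.

(** * Nested convex subsets of an order interval *)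

Section order_continuous.
Context {R : realType} {X : completeNormedModType R} {K : set X}.
Hypotheses (BL : banach_lattice K) (OC : order_continuous_norm K).
Local Notation "x <=v y" := (cone_le K x y) (at level 70).
Local Notation vabs := (vabs K).
Local Notation vpos := (vpos K).
Local Notation ceq := (@cone_eq _ _ K _ _).

Let HK : is_cone K. Proof. by have [[]] := BL. Qed.
Let Kcl : closed K. Proof. by have [[]] := BL. Qed.
Let HL : vector_lattice K. Proof. by have [] := BL. Qed.

Lemma norm_le_vabs x y : vabs x <=v vabs y -> `|x| <= `|y|.
Proof. by have [_ _] := BL; apply; exact: vsupP. Qed.

Lemma norm_vabs x : `|vabs x| = `|x|.
Proof.
have xx := vabs_id HK HL (vabs_pos HK HL x).
by apply/le_anti/andP; split; apply: norm_le_vabs; rewrite xx; exact: cle_refl.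
Qed.

Lemma norm_le_cone x y : K x -> x <=v y -> `|x| <= `|y|.
Proof.
move=> Kx xy; have Ky : K y by apply: (ceq (coneD HK Kx xy)); lmod R.
by apply: norm_le_vabs; rewrite !vabs_id.
Qed.

(** Order continuity gives the norm limit; closedness of the cone makes this limit the supremum. *)
Lemma order_bounded_seq_cvg (x : nat -> X) b : (forall n, K (x n)) ->
  (forall n, x n <=v x n.+1) -> (forall n, x n <=v b) ->
  exists l, [/\ forall e : R, 0 < e -> exists N, forall n, (N <= n)%N -> `|x n - l| <= e,
    forall n, x n <=v l & forall u, (forall n, x n <=v u) -> l <=v u].
Proof.
move=> Kx xS xb.
have x_mono m n : (m <= n)%N -> x m <=v x n.
  move=> mn; rewrite -(subnK mn); elim: (n - m)%N => [|k IH]; first exact: cle_refl.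
  exact: (cle_trans HK IH).
have [||||l /net_cvgP xl] := OC (le := fun i j => (i <= j)%N) (x := x).
- split=> [|//|i j k|i j]; first exact: inhabits 0%N.
    exact: leq_trans.
  by exists (maxn i j); rewrite leq_maxl leq_maxr.
- exact: Kx.
- exact: x_mono.
- by exists (x 0%N), b => n; split => //; exact: x_mono.
exists l; split.
- by move=> e e0; have [N xN] := xl e e0; exists N => n /xN/ltW.
- move=> n; apply: (closed_approx Kcl) => e e0; have [N xN] := xl e e0.
  exists (x (maxn N n) - x n); first by apply: x_mono; exact: leq_maxr.
  have -> : x (maxn N n) - x n - (l - x n) = x (maxn N n) - l by lmod R.
  by rewrite ltW// xN// leq_maxl.
- move=> u xu; apply: (closed_approx Kcl) => e e0; have [N xN] := xl e e0.
  exists (u - x N); first exact: xu.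
  have -> : u - x N - (u - l) = - (x N - l) by lmod R.
  by rewrite normrN ltW// xN.
Qed.

Definition positive_functional (f : {linear X -> R^o}) := forall x, K x -> 0 <= f x.

Lemma positive_functional_le (f : {linear X -> R^o}) x y :
  positive_functional f -> x <=v y -> f x <= f y.
Proof. by move=> f_pos /f_pos; rewrite linearB subr_ge0. Qed.

(** On [h + K] the norm is at least [|h|] by monotonicity, so this set can be separated from 0. A
    functional bounded below on [h + K] is positive on [K]. *)
Lemma positive_norming h : K h -> exists f : {linear X -> R^o},
  [/\ positive_functional f, forall x, `|f x| <= `|x| & `|h| <= f h].
Proof.
move=> Kh.
have [|||f [f1 fh]] := @convex_separation R X [set h + k | k in K] `|h|.
- by exists (h + 0), 0; first exact: cone0.
- move=> a b _ _ a0 b0 ab [k Kk <-] [k' Kk' <-].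
  exists (a *: k + b *: k'); first by apply: coneD => //; exact: coneZ.
  have -> : b = 1 - a by [lra].
  by lmod R.
- move=> _ [k Kk <-]; apply: norm_le_cone => //.
  by apply: (ceq Kk); lmod R.
have fhh : `|h| <= f h.
  by rewrite -[h in leRHS]addr0; apply: fh; exists 0; first exact: cone0.
exists f; split => // k Kk; rewrite leNgt; apply/negP => fk.
(* With this factor, [f] takes the value [-1] at [h] plus the multiple of [k]. *)
have t0 : 0 <= (f h + 1) / - f k by rewrite divr_ge0//; have := normr_ge0 h; lra.
have := fh _ (ex_intro2 _ _ _ (coneZ HK t0 Kk) erefl).
rewrite linearD functionalZ invrN mulrN mulNr divfK ?lt_eqF//.
by have := normr_ge0 h; lra.
Qed.

Definition nested (e : X) (B : nat -> set X) :=
  [/\ forall n, B n !=set0, forall n, is_convex (B n),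
      forall n, B n.+1 `<=` B n & forall n x, B n x -> K x /\ x <=v e].

Lemma nested_sub e B m n : nested e B -> (m <= n)%N -> B n `<=` B m.
Proof.
move=> [_ _ BS _] mn; rewrite -(subnK mn); elim: (n - m)%N => [//|k IH].
exact: subset_trans (BS _) IH.
Qed.

Lemma nested_shrink_functional e B (f : {linear X -> R^o}) (eps : R) :
  positive_functional f -> nested e B -> 0 < eps ->
  exists B', [/\ nested e B', forall n, B' n `<=` B n &
    forall a b, B' 0%N a -> B' 0%N b -> f (vabs (a - b)) <= eps].
Proof.
move=> f_pos Bnest eps0; have [B_ne B_cvx BS Be] := Bnest.
have eps4 : 0 < eps / 4 by lra.
have [k ke] := half_pow_small (f e) eps4.
have [T HT] := dyadic_net HK HL e k (ler01 : 0 <= 1 :> R).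
pose Psi y := \sum_(t <- T) f (vabs (y - t *: e)).
have Ke : K e.
  have [x /Be[Kx xe]] := B_ne 0%N.
  by apply: (ceq (coneD HK Kx xe)); lmod R.
have Psi0 y : 0 <= Psi y by apply: sumr_ge0 => t _; apply: f_pos; exact: vabs_pos.
have Psi_cvx a b x y : 0 <= a -> 0 <= b -> a + b = 1 ->
    Psi (a *: x + b *: y) <= a * Psi x + b * Psi y.
  move=> a0 b0 ab; rewrite /Psi !mulr_sumr -big_split /=; apply: ler_sum => t _.
  rewrite -!functionalZ -linearD; apply: positive_functional_le => //.
  have -> : a *: x + b *: y - t *: e = a *: (x - t *: e) + b *: (y - t *: e).
    have -> : b = 1 - a by [lra].
    by lmod R.
  apply: (cle_trans HK (vabsD HK HL _ _)).
  by rewrite !vabsZ// !ger0_norm//; exact: cle_refl.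
pose M := \sum_(t <- T) f ((1 + `|t|) *: e).
have PsiM n x : B n x -> Psi x <= M.
  move=> /Be[Kx xe]; apply: ler_sum => t _; apply: positive_functional_le => //.
  apply: (cle_trans HK (vabsD HK HL _ _)); rewrite vabsN// vabsZ// !vabs_id//.
  by apply: (ceq xe); lmod R.
(* [sup S] is the limit of the increasing infima of [Psi] over [B n]. From the index [n0] on, these
   infima are within [eps / 8] of it, and [B'] keeps the near-minimizers. *)
pose S := [set r : R | exists n, forall c, B n c -> r <= Psi c].
have S_sup : has_sup S.
  split; first by exists 0, 0%N => c _; exact: Psi0.
  exists M => r [n rn]; have [c Bc] := B_ne n.
  exact: le_trans (rn c Bc) (PsiM n c Bc).
have eps8 : 0 < eps / 8 by lra.
have [r [n0 rn0] r_sup] := sup_adherent eps8 S_sup.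
pose B' n := [set c | B (n0 + n)%N c /\ Psi c <= sup S + eps / 8].
exists B'; split.
- split.
  + move=> n; apply: contrapT => B'0.
    have : S (sup S + eps / 8).
      exists (n0 + n)%N => c Bc; rewrite leNgt; apply/negP => Pc.
      by apply: B'0; exists c; split => //; exact: ltW.
    by move=> /(ub_le_sup S_sup.2); lra.
  + move=> n a b x y a0 b0 ab [Bx xs] [By ys]; split; first exact: B_cvx.
    apply: le_trans (Psi_cvx _ _ _ _ a0 b0 ab) _.
    have := ler_wpM2l a0 xs; have := ler_wpM2l b0 ys.
    have -> : b = 1 - a by [lra].
    lra.
  + by move=> n x [Bx xs]; split => //; apply: BS; rewrite -addnS.
  + by move=> n x [/Be].
- by move=> n x [Bx _]; apply: (nested_sub Bnest _ Bx); exact: leq_addl.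
move=> a b [Ba aS] [Bb bS]; rewrite addn0 in Ba Bb.
(* The midpoint [m] lies in [B n0], so [Psi a + Psi b - 2 * Psi m] is at most [eps / 2]. By [gap]
   the sum over the net is then at most [eps / 4]; the error of the net adds [eps / 4], and
   [a - b = 2 *: d] doubles the total to [eps]. *)
set m := 2^-1 *: a + 2^-1 *: b; set d := 2^-1 *: (a - b).
have Bm : B n0 m by apply: B_cvx => //; lra.
have mS := rn0 _ Bm.
have gap : 2 * \sum_(t <- T) f (vpos (vabs d - vabs (m - t *: e))) <=
    Psi a + Psi b - 2 * Psi m.
  rewrite /Psi !mulr_sumr -big_split -sumrB /=; apply: ler_sum => t _.
  have -> : a - t *: e = m - t *: e + d by rewrite /m /d; lmod R.
  have -> : b - t *: e = m - t *: e - d by rewrite /m /d; lmod R.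
  rewrite -!functionalZ -linearD -linearB; apply: positive_functional_le => //.
  exact: vabs_convex_gap_ge.
have me : vabs m <=v 1 *: e.
  have [Kx xe] := Be _ _ Bm; rewrite vabs_id// scale1r; exact: xe.
have /(positive_functional_le f_pos) := HT m _ me (vabs_pos HK HL d).
rewrite mul1r linearD functionalZ linear_sum /= => dle.
have -> : a - b = 2 *: d by rewrite /d; lmod R.
rewrite vabsZ// ger0_norm// functionalZ.
by rewrite [f e * _]mulrC in ke; lra.
Qed.

Fixpoint partial_sup (h : nat -> X) n : X :=
  if n is m.+1 then vsup K (partial_sup h m) (h m.+1) else h 0%N.

(** Let [g n] be the supremum of [h k] over [k >= n] and [G] the limit of the [g n]. Summability
    gives [F j G <= 0] for all [j]. For large [N], [(F N.+1 - F N) (h N)] is at most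
    [(F N.+1 - F N) (g N)], hence at most [|g N - G| <= eps]. *)
Lemma no_escaping_sequence e (h : nat -> X) (F : nat -> {linear X -> R^o}) (eps : R) :
  0 < eps -> (forall k, K (h k) /\ h k <=v e) ->
  (forall k, positive_functional (F k)) ->
  (forall k, exists C : R, forall x, `|F k x| <= C * `|x|) ->
  (forall k x, K x -> F k x <= F k.+1 x <= F k x + `|x|) ->
  (forall k, F k (h k) <= 2^-1 ^+ k) ->
  ~ forall k, eps < F k.+1 (h k) - F k (h k).
Proof.
move=> eps0 he F_pos F_bnd FS Fh Feps.
have F_mono j k x : (j <= k)%N -> K x -> F j x <= F k x.
  move=> jk Kx; rewrite -(subnK jk); elim: (k - j)%N => [//|i IH].
  by apply: le_trans IH _; have /andP[] := FS (i + j)%N x Kx.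
(* [s n m] is the supremum of [h n], ..., [h (n + m)]. *)
pose s n := partial_sup (fun i => h (n + i)%N).
have Ks n m : K (s n m).
  elim: m => [|m IH]; first exact: (he _).1.
  have H : s n m <=v s n m.+1 by exact: vsup_ge1.
  by apply: (ceq (coneD HK IH H)); lmod R.
have se n m : s n m <=v e.
  by elim: m => [|m IH]; [exact: (he _).2|apply: vsup_le => //; exact: (he _).2].
have g_ex n : exists l, [/\ forall d : R, 0 < d -> exists N, forall m, (N <= m)%N ->
    `|s n m - l| <= d, forall m, s n m <=v l &
    forall u, (forall m, s n m <=v u) -> l <=v u].
  by apply: order_bounded_seq_cvg (Ks n) _ (se n) => m; exact: vsup_ge1.
have [g gP] := choice g_ex.
have hg n i : h (n + i)%N <=v g n.
  have [_ sg _] := gP n; apply: (cle_trans HK _ (sg i)).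
  by case: i => [|i]; [exact: cle_refl|exact: vsup_ge2].
have g_le n u : (forall i, h (n + i)%N <=v u) -> g n <=v u.
  move=> hu; have [_ _] := gP n; apply=> m.
  by elim: m => [|m IH]; [exact: hu|apply: vsup_le].
have gS n : g n.+1 <=v g n by apply: g_le => i; rewrite addSnnS.
have ge n : g n <=v e by apply: g_le => i; exact: (he _).2.
have Kg n : K (g n).
  have H := hg n 0%N; have Kh := (he (n + 0)%N).1.
  by apply: (ceq (coneD HK Kh H)); lmod R.
(* Convergence is known for increasing sequences, so [g] is reflected in [e]; the limit superior of
   [h] is [e - l]. *)
have [|||l [gl lge lle]] := @order_bounded_seq_cvg (fun n => e - g n) e.
- by move=> n; exact: ge.
- by move=> n; apply: (ceq (gS n)); lmod R.
- by move=> n; apply: (ceq (Kg n)); lmod R.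
have KG : K (e - l).
  by apply: lle => n; apply: (ceq (Kg n)); lmod R.
have Gg n : e - l <=v g n by apply: (ceq (lge n)); lmod R.
(* A supremum of positive elements is below their sum; the right-hand side is the sum of
   [2^-1 ^+ (n + i)] over [i <= m]. *)
have Fs j n m : (j <= n)%N -> F j (s n m) <= 2 * 2^-1 ^+ n - 2^-1 ^+ (n + m).
  move=> jn.
  have Fhk i : F j (h (n + i)%N) <= 2^-1 ^+ (n + i).
    apply: le_trans (F_mono j (n + i)%N _ _ (he _).1) (Fh _).
    exact: leq_trans jn (leq_addr _ _).
  elim: m => [|m IH]; first by have := Fhk 0%N; rewrite /s /= !addn0; lra.
  have : F j (s n m.+1) <= F j (s n m + h (n + m.+1)%N).
    have H1 : s n m <=v s n m + h (n + m.+1)%N.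
      by apply: (ceq (he (n + m.+1)%N).1); lmod R.
    have H2 : h (n + m.+1)%N <=v s n m + h (n + m.+1)%N.
      by apply: (ceq (Ks n m)); lmod R.
    by apply: positive_functional_le => //; exact: (vsup_le HL H1 H2).
  by have := Fhk m.+1; rewrite linearD addnS exprS; lra.
have Fg j n : (j <= n)%N -> F j (g n) <= 2 * 2^-1 ^+ n.
  move=> jn; apply/ler_addgt0Pr => d d0.
  have [C FC] := F_bnd j; have C0 : 0 < `|C| + 1 by have := normr_ge0 C; lra.
  have [sg _ _] := gP n; have [N /(_ N (leqnn N)) sN] := sg _ (divr_gt0 d0 C0).
  rewrite ler_pdivlMr// in sN.
  have E : 0 <= 2^-1 ^+ (n + N) :> R by apply: exprn_ge0; lra.
  have := Fs j n N jn; have := FC (s n N - g n); rewrite linearB ler_norml => /andP[+ _].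
  have := ler_wpM2r (normr_ge0 (s n N - g n)) (ler_norm C).
  by have := normr_ge0 (s n N - g n); lra.
have FG j : F j (e - l) <= 0.
  apply/ler_addgt0Pr => d d0; rewrite add0r; have [n nd] := half_pow_small 2 d0.
  have E : 0 <= 2^-1 ^+ n :> R by apply: exprn_ge0; lra.
  apply: le_trans (positive_functional_le (F_pos j) (Gg (n + j)%N)) _.
  apply: le_trans (Fg j (n + j)%N (leq_addl _ _)) (le_trans _ nd).
  rewrite exprD; have : 2^-1 ^+ j <= 1 :> R by apply: exprn_ile1; lra.
  by move=> /(ler_wpM2l E); lra.
have [N /(_ N (leqnn N)) gN] := gl eps eps0.
have gNE : `|g N - (e - l)| <= eps.
  have -> : g N - (e - l) = - (e - g N - l) by lmod R.
  by rewrite normrN.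
have := Feps N.
have K1 : K (g N - h N) by have := hg N 0%N; rewrite addn0.
have /andP[F1 _] := FS N _ K1; have /andP[_ F2] := FS N _ (Gg N).
have := FG N.+1; have := F_pos N _ KG; move: F1 F2.
by rewrite !(linearB (F N)) !(linearB (F N.+1)); lra.
Qed.

Lemma nested_shrink_norm e B (eps : R) : nested e B -> 0 < eps ->
  exists B', [/\ nested e B', forall n, B' n `<=` B n &
    forall a b, B' 0%N a -> B' 0%N b -> `|a - b| <= eps].
Proof.
move=> Bnest eps0; apply: contrapT => no_shrink.
(* A state holds the current nested sets, the sum [F] of the functionals chosen so far, and the last
   witness [h]. At stage [k] the first set has [F]-diameter at most [2^-1 ^+ k], so the next witness
   [|a - b|], with [a] and [b] in it, is small for all earlier functionals while its own norming
   functional exceeds [eps]. *)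
pose St := ((nat -> set X) * {linear X -> R^o} * X)%type.
pose P k (s : St) := [/\ nested e s.1.1, forall n, s.1.1 n `<=` B n,
  positive_functional s.1.2, exists C : R, forall x, `|s.1.2 x| <= C * `|x| &
  forall a b, s.1.1 0%N a -> s.1.1 0%N b -> s.1.2 (vabs (a - b)) <= 2^-1 ^+ k].
pose Q k (s s' : St) := [/\ K s'.2, s'.2 <=v e, s.1.2 s'.2 <= 2^-1 ^+ k,
  eps < s'.1.2 s'.2 - s.1.2 s'.2 &
  forall x, K x -> s.1.2 x <= s'.1.2 x <= s.1.2 x + `|x|].
have step (ks : {ks : nat * St | P ks.1 ks.2}) :
    {ks' : {ks : nat * St | P ks.1 ks.2} |
      (sval ks').1 = (sval ks).1.+1 /\ Q (sval ks).1 (sval ks).2 (sval ks').2}.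
  apply: cid; case: ks => [[k [[B1 F] h0]] [B1nest B1B F_pos [C FC] Fk]] /=.
  have [a [b [Ba Bb ab]]] : exists a b, [/\ B1 0%N a, B1 0%N b & eps < `|a - b|].
    apply: contrapT => no_ab; apply: no_shrink; exists B1; split => // a b Ba Bb.
    by rewrite leNgt; apply/negP => ab; apply: no_ab; exists a, b.
  have Kh := vabs_pos HK HL (a - b).
  have [f [f_pos f1 fh]] := positive_norming Kh.
  have [F' F'E] : exists F' : {linear X -> R^o}, forall x, F' x = F x + f x.
    by exists (F \+ f).
  have F'_pos : positive_functional F'.
    by move=> x Kx; rewrite F'E addr_ge0// ?F_pos ?f_pos.
  have d0 : 0 < 2^-1 ^+ k.+1 :> R by apply: exprn_gt0; lra.
  have [B2 [B2nest B2B1 B2F]] := nested_shrink_functional F'_pos B1nest d0.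
  have Ps : P k.+1 (B2, F', vabs (a - b)).
    split => //=; first by move=> n; exact: subset_trans (B2B1 n) (B1B n).
    exists (C + 1) => x; rewrite F'E; have := ler_normD (F x) (f x).
    have := FC x; have := f1 x; lra.
  exists (exist (fun ks : nat * St => P ks.1 ks.2) (k.+1, _) Ps) => /=; split => //.
  have [_ _ _ B1e] := B1nest.
  split => //=.
  - have [Ka ae] := B1e _ _ Ba; have [Kb be] := B1e _ _ Bb.
    apply: vabs_le => //; first by apply: (ceq (coneD HK Kb ae)); lmod R.
    by apply: (ceq (coneD HK Ka be)); lmod R.
  - exact: Fk.
  - by rewrite F'E addrAC subrr add0r; apply: lt_le_trans fh; rewrite norm_vabs.
  - move=> x Kx; rewrite F'E lerDl f_pos//= lerD2l.
    exact: le_trans (ler_norm _) (f1 x).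
have P0 : P 0%N (B, (\0 : {linear X -> R^o}), 0 : X).
  split.
  - exact: Bnest.
  - by move=> n; exact: subset_refl.
  - by move=> x Kx; exact: (lexx (0 : R)).
  - by exists 0 => x; rewrite mul0r /= normr0.
  - by move=> a b _ _; rewrite expr0; exact: (ler01 : 0 <= 1 :> R).
have [u [u0 uS]] := dependent_choice step
  (exist (fun ks : nat * St => P ks.1 ks.2) (0%N, _) P0).
have uk n : (sval (u n)).1 = n.
  by elim: n => [|n IH]; [rewrite u0|rewrite (uS n).1 IH].
(* The witness found at stage [n] is stored in state [n.+1]; the initial witness [0] is a dummy. *)
apply: (@no_escaping_sequence e (fun n => (sval (u n.+1)).2.2)
  (fun n => (sval (u n)).2.1.2) eps eps0).
- by move=> k; have [] := (uS k).2.
- by move=> k; have [] := svalP (u k).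
- by move=> k; have [] := svalP (u k).
- by move=> k x Kx; have [_ _ _ _] := (uS k).2; apply.
- by move=> k; have [_ _] := (uS k).2; rewrite uk.
- by move=> k; have [] := (uS k).2.
Qed.

(** Shrinking repeatedly gives sequences of sets with diameters at most [2^-1 ^+ k]. The diagonal
    choice [c k], in the [k]-th set of the [k]-th sequence, is Cauchy, and [c (n + k)] lies in
    [B n]. *)
Lemma nested_cluster e B : nested e B ->
  exists c, forall n (eps : R), 0 < eps -> exists2 b, B n b & `|b - c| <= eps.
Proof.
move=> Bnest.
pose P k (B' : nat -> set X) := [/\ nested e B', forall n, B' n `<=` B n &
  forall a b, B' 0%N a -> B' 0%N b -> `|a - b| <= 2^-1 ^+ k].
have E k : 0 < 2^-1 ^+ k :> R by apply: exprn_gt0; lra.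
have step (ks : {ks : nat * (nat -> set X) | P ks.1 ks.2}) :
    {ks' : {ks : nat * (nat -> set X) | P ks.1 ks.2} |
      (sval ks').1 = (sval ks).1.+1 /\
      forall n, (sval ks').2 n `<=` (sval ks).2 n}.
  apply: cid; case: ks => [[k B1] [B1nest B1B B1k]] /=.
  have [B2 [B2nest B2B1 B2k]] := nested_shrink_norm B1nest (E k.+1).
  have Ps : P k.+1 B2.
    by split => // n; exact: subset_trans (B2B1 n) (B1B n).
  by exists (exist (fun ks : nat * (nat -> set X) => P ks.1 ks.2) (k.+1, _) Ps).
have [B0 [B0nest B0B B0k]] := nested_shrink_norm Bnest (E 0%N).
have P0 : P 0%N B0 by [].
have [u [u0 uS]] := dependent_choice step
  (exist (fun ks : nat * (nat -> set X) => P ks.1 ks.2) (0%N, _) P0).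
have uk n : (sval (u n)).1 = n.
  by elim: n => [|n IH]; [rewrite u0|rewrite (uS n).1 IH].
have /choice[c cP] k : exists x, (sval (u k)).2 k x.
  by have [[+ _ _ _] _ _] := svalP (u k); apply.
have cu k : (sval (u k)).2 0%N (c k).
  by have [nu _ _] := svalP (u k); exact: (nested_sub nu (leq0n k)).
have [|l cl] := @geometric_cvg _ _ c 1.
  move=> k; rewrite mul1r; have [nu _] := svalP (u k); rewrite uk; apply => //.
  by apply: (uS k).2; exact: cu.
exists l => n eps eps0; have [k ke] := half_pow_small (2 * 1) eps0.
have E0 : 0 <= 2^-1 ^+ k :> R := ltW (E k).
exists (c (n + k)%N).
  have [nu uB _] := svalP (u (n + k)%N); apply: uB.
  exact: (nested_sub nu (leq_addr k n)).
apply: le_trans (cl _) (le_trans _ ke); rewrite exprD.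
have : 2^-1 ^+ n <= 1 :> R by apply: exprn_ile1; lra.
by move=> /(ler_wpM2r E0); lra.
Qed.

End order_continuous.

(** * Cluster points of forward convex combinations *)

Section convex_cluster.
Context {R : realType}.

(** The convex hull of a tail, encoded as an intersection: a property passes to the hull by choosing
    a convex set [A], without handling finite combinations. *)
Definition tail_hull {V : lmodType R} (w : nat -> V) n : set V :=
  [set x | forall A, is_convex A -> (forall k, (n <= k)%N -> A (w k)) -> A x].

Lemma tail_hull_mem {V : lmodType R} (w : nat -> V) n k :
  (n <= k)%N -> tail_hull w n (w k).
Proof. by move=> nk A _; apply. Qed.

Lemma tail_hull_convex {V : lmodType R} (w : nat -> V) n : is_convex (tail_hull w n).
Proof.
move=> a b x y a0 b0 ab wx wy A Acvx Aw.
exact: (Acvx a b x y a0 b0 ab (wx A Acvx Aw) (wy A Acvx Aw)).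
Qed.

Lemma tail_hull_sub {V : lmodType R} (w : nat -> V) m n :
  (m <= n)%N -> tail_hull w n `<=` tail_hull w m.
Proof.
by move=> mn x wx A Acvx Aw; apply: wx => // k nk; apply: Aw; exact: leq_trans mn nk.
Qed.

Definition weak_cvg {V : normedModType R} (u : nat -> V) l :=
  forall phi : {linear V -> R^o}, bounded_fun_norm phi ->
    phi (u n) @[n --> \oo] --> phi l.

Lemma bounded_linear_cvg {V W : normedModType R} (f : {linear V -> W}) (u : nat -> V) l :
  bounded_fun_norm f -> u n @[n --> \oo] --> l -> f (u n) @[n --> \oo] --> f l.
Proof.
move=> /bounded_norm_le[C C0 fC] /seq_cvgP ul; apply/seq_cvgP => e e0.
have [N uN] := ul _ (divr_gt0 e0 C0); exists N => n /uN.
rewrite ler_pdivlMr// mulrC -(linearB f); exact: (le_trans (fC _)).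
Qed.

Lemma norm_cvg_weak {V : normedModType R} (u : nat -> V) l :
  u n @[n --> \oo] --> l -> weak_cvg u l.
Proof. by move=> ul phi phib; exact: bounded_linear_cvg. Qed.

(** A substitute for weak cluster points: [z] lies in the norm closure of the convex hull of every
    tail. Bounded linear maps and inequalities for closed cones are compatible with it. *)
Definition convex_cluster {V : normedModType R} (w : nat -> V) z :=
  forall n (e : R), 0 < e -> exists2 x, tail_hull w n x & `|x - z| <= e.

Lemma convex_cluster_linear {V W : normedModType R} (f : {linear V -> W}) w z :
  bounded_fun_norm f -> convex_cluster w z -> convex_cluster (f \o w) (f z).
Proof.
move=> /bounded_norm_le[C C0 fC] wz n e e0.
have [x wx xz] := wz n _ (divr_gt0 e0 C0); exists (f x).
  move=> A Acvx Aw; apply: (wx [set v | A (f v)]) => //.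
  by move=> a b u v a0 b0 ab Au Av; rewrite /= linearP linearZ; exact: Acvx.
by move: xz; rewrite ler_pdivlMr// mulrC -(linearB f); exact: (le_trans (fC _)).
Qed.

(** Convex combinations of [f (w k)] are images of the same combinations of [w k], and [f] is
    bounded below. This pulls cluster points back through [S]. *)
Lemma convex_cluster_preimage {V W : normedModType R} (f : {linear V -> W}) w z C :
  0 < C -> (forall x, `|x| <= C * `|f x|) ->
  convex_cluster (f \o w) (f z) -> convex_cluster w z.
Proof.
move=> C0 fC fwz n e e0; have [y wy yz] := fwz n _ (divr_gt0 e0 C0).
have [x wx xy] : exists2 x, tail_hull w n x & f x = y.
  apply: (wy [set y | exists2 x, tail_hull w n x & f x = y]).
    move=> a b _ _ a0 b0 ab [u wu <-] [v wv <-]; exists (a *: u + b *: v).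
      exact: tail_hull_convex.
    by rewrite linearP linearZ.
  by move=> k nk; exists (w k) => //; exact: tail_hull_mem.
exists x => //; apply: le_trans (fC _) _.
by rewrite linearB xy mulrC -ler_pdivlMr.
Qed.

(* A closed cone is weakly closed. *)
Lemma convex_cluster_le {V : normedModType R} (K : set V) w r z u :
  is_cone K -> closed K -> (forall k : nat, cone_le K (w k) (r k)) ->
  weak_cvg r u -> convex_cluster w z -> cone_le K z u.
Proof.
move=> HK Kcl wr ru wz; apply: contrapT => nKuz.
have [d d0 Kd] : exists2 d : R, 0 < d & forall k, K k -> d <= `|k - (u - z)|.
  apply: contrapT => no; apply: nKuz; apply: (closed_approx Kcl) => e e0.
  apply: contrapT => no_k; apply: no; exists e => // k Kk; rewrite leNgt.
  by apply/negP => lt; apply: no_k; exists k => //; exact: ltW.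
have [|||f [f1 fC]] := @convex_separation R V [set k - (u - z) | k in K] d.
- by exists (0 - (u - z)), 0 => //; exact: cone0.
- move=> a b _ _ a0 b0 ab [k Kk <-] [k' Kk' <-]; exists (a *: k + b *: k').
    by apply: coneD => //; exact: coneZ.
  have -> : b = 1 - a by [lra].
  by lmod R.
- by move=> _ [k Kk <-]; exact: Kd.
have fb : bounded_fun_norm f by apply: (@norm_le_bounded _ _ _ _ 1) => x; rewrite mul1r.
have fK k : K k -> d <= f k - f (u - z).
  by move=> Kk; rewrite -(linearB f); apply: fC; exists k.
have f_pos k : K k -> 0 <= f k.
  move=> Kk; rewrite leNgt; apply/negP => fk.
  have fuz : 0 <= - f (u - z).
    by have := fK 0 (cone0 HK); rewrite linear0; lra.
  (* At this multiple of [k] the value of [f] is [f (u - z)], which contradicts the gap [d]. *)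
  have t0 : 0 <= f (u - z) / f k by apply: mulr_le0; rewrite ?invr_le0; lra.
  have := fK _ (coneZ HK t0 Kk); rewrite functionalZ divfK ?lt_eqF//; lra.
(* [f z] exceeds [f u] by at least [d], whereas convergence of [f (r k)] and approximation of [z] by
   a convex combination allow only [d / 3] each. *)
have d3 : 0 < d / 3 by lra.
have /seq_cvgP/(_ _ d3)[N rN] := ru f fb.
have [x wx xz] := wz N _ d3.
have fx : f x <= f u + d / 3.
  apply: (wx [set x | f x <= f u + d / 3]).
    move=> a b v v' a0 b0 ab /= fv fv'; rewrite linearD !functionalZ.
    have := ler_wpM2l a0 fv; have := ler_wpM2l b0 fv'.
    have -> : b = 1 - a by [lra].
    lra.
  move=> k /rN; rewrite ler_norml => /andP[_ fr] /=.
  by have := f_pos _ (wr k); rewrite linearB; lra.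
have := f1 (x - z); rewrite linearB ler_norml => /andP[fxz _].
by have := fK 0 (cone0 HK); rewrite linear0 linearB; lra.
Qed.

Lemma convex_cluster_ge {V : normedModType R} (K : set V) w r z u :
  is_cone K -> closed K -> (forall k : nat, cone_le K (r k) (w k)) ->
  weak_cvg r u -> convex_cluster w z -> cone_le K u z.
Proof.
move=> HK Kcl rw ru wz.
pose opp : {linear V -> V} := -%R.
have oppb : bounded_fun_norm opp.
  by apply: (@norm_le_bounded _ _ _ _ 1) => x; rewrite normrN mul1r.
have := convex_cluster_le HK Kcl (fun k => cleN (rw k)) _
  (convex_cluster_linear oppb wz).
move=> /(_ (- u)) H; rewrite -(opprK u) -(opprK z); apply: cleN; apply: H.
move=> phi phib; under eq_fun do rewrite linearN.
by rewrite linearN; apply: cvgN; exact: ru.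
Qed.

Lemma convex_cluster_unique {V : normedModType R} (K : set V) (w : nat -> V) z u :
  is_cone K -> closed K -> w n @[n --> \oo] --> u -> convex_cluster w z -> z = u.
Proof.
move=> HK Kcl /norm_cvg_weak wu wz; apply: (cle_anti HK).
  exact: (convex_cluster_le HK Kcl (fun=> cle_refl HK _) wu wz).
exact: (convex_cluster_ge HK Kcl (fun=> cle_refl HK _) wu wz).
Qed.

(* Mazur's lemma for the second components, keeping track of the first ones. *)
Lemma mazur_pair {V W : normedModType R} (h : nat -> V) (g : nat -> W) g0 n (e : R) :
  0 < e -> weak_cvg g g0 ->
  exists2 p : V * W, tail_hull (fun k => (h k, g k) : (V * W)%type) n p &
    `|p.2 - g0| <= e.
Proof.
move=> e0 gg0; apply: contrapT => no.
pose W' := tail_hull (fun k => (h k, g k) : (V * W)%type) n.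
have [|||f [f1 fC]] := @convex_separation R W [set p.2 - g0 | p in W'] e.
- by exists (g n - g0), (h n, g n) => //; exact: (@tail_hull_mem _ _ n n).
- move=> a b _ _ a0 b0 ab [p Wp <-] [q Wq <-]; exists (a *: p + b *: q).
    exact: tail_hull_convex.
  have -> : b = 1 - a by [lra].
  rewrite /=; by lmod R.
- move=> _ [p Wp <-]; rewrite leNgt; apply/negP => lt; apply: no.
  by exists p => //; exact: ltW.
have fb : bounded_fun_norm f by apply: (@norm_le_bounded _ _ _ _ 1) => x; rewrite mul1r.
have e2 : 0 < e / 2 by lra.
have /seq_cvgP/(_ _ e2)[N gN] := gg0 f fb.
have := gN _ (leq_maxl N n); rewrite -(linearB f) ler_norml => /andP[_].
have : e <= f (g (maxn N n) - g0).
  apply: fC; exists (h (maxn N n), g (maxn N n)) => //.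
  exact: (@tail_hull_mem _ _ n (maxn N n) (leq_maxr _ _)).
lra.
Qed.

End convex_cluster.

(** * Cluster points of positive sequences below a weakly convergent one *)

Section dominated.
Context {R : realType} {X : completeNormedModType R} {K : set X}.
Hypotheses (BL : banach_lattice K) (OC : order_continuous_norm K).
Local Notation "x <=v y" := (cone_le K x y) (at level 70).
Local Notation ceq := (@cone_eq _ _ K _ _).

(** By Mazur's lemma, simultaneous convex combinations of [(h k, g k)] have second component near
    [g0]. The first component, truncated at [g0], moves by no more than this error, so the
    truncations form nested convex sets in the order interval from 0 to [g0]. *)
Lemma dominated_convex_cluster (h g : nat -> X) g0 :
  (forall n, K (h n)) -> (forall n, h n <=v g n) -> weak_cvg g g0 ->
  exists c, convex_cluster h c.
Proof.
move=> Kh hg gg0; have [[_ HK Kcl] HL _] := BL.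
have Kg0 : K g0.
  apply/(@cle0 _ _ K)/(convex_cluster_le HK Kcl (w := fun=> 0) _ gg0) => [k|n e e0].
    by apply: (ceq (coneD HK (Kh k) (hg k))); lmod R.
  exists 0; first exact: (@tail_hull_mem _ _ (fun=> 0) n n).
  by rewrite subrr normr0 ltW.
pose W n := tail_hull (fun k => (h k, g k) : (X * X)%type) n.
have E n : 0 < 2^-1 ^+ n :> R by apply: exprn_gt0; lra.
pose B n := [set c | [/\ K c, cone_le K c g0 & exists p : X * X,
  [/\ W n p, `|p.2 - g0| <= 2^-1 ^+ n & `|p.1 - c| <= 2^-1 ^+ n]]].
have W_h n p : W n p -> tail_hull h n p.1.
  move=> Wp A Acvx Ah; apply: (Wp [set q | A q.1]) => //.
  by move=> a b q q' a0 b0 ab /= Aq Aq'; exact: Acvx.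
have W_pos n p : W n p -> K p.1 /\ cone_le K p.1 p.2.
  move=> Wp; apply: (Wp [set q | K q.1 /\ cone_le K q.1 q.2]); last first.
    by move=> k _; split; [exact: Kh|exact: hg].
  move=> a b q q' a0 b0 ab /= [Kq qq] [Kq' qq']; split.
    by apply: coneD => //; exact: coneZ.
  by apply: cleD => //; exact: cleZ.
have Bnest : @nested R X K g0 B.
  split=> [n|n|n|n].
  - have [[h' g'] Wp /= pg] := mazur_pair h n (E n) gg0.
    have [/= Kh' hg'] := W_pos n _ Wp.
    (* [h' - v] is the infimum of [h'] and [g0], and [v] is below [|g' - g0|] because [h' <= g']. *)
    pose v := vpos K (h' - g0).
    have v_ge : h' - g0 <=v v by exact: vpos_ge.
    have v_le : v <=v h' by apply: vpos_le => //; apply: (ceq Kg0); lmod R.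
    exists (h' - v); split; first exact: v_le.
      by apply: (ceq v_ge); lmod R.
    exists (h', g'); split => //=.
    have -> : h' - (h' - v) = v by lmod R.
    apply: le_trans pg; rewrite -[leRHS](norm_vabs BL).
    apply: (norm_le_cone BL); first exact: (vpos_pos HL).
    apply: vpos_le => //; last exact: vabs_pos.
    apply: (cle_trans HK _ (vabs_ge HL _)).
    by apply: (ceq hg'); lmod R.
  - move=> a b x y a0 b0 ab [Kx xg [p [Wp pg px]]] [Ky yg [q [Wq qg qy]]].
    have cvx_le (v v' : X) : `|v| <= 2^-1 ^+ n -> `|v'| <= 2^-1 ^+ n ->
        `|a *: v + b *: v'| <= 2^-1 ^+ n.
      move=> ve v'e; apply: le_trans (ler_normD _ _) _; rewrite !normrZ !ger0_norm//.
      have := ler_wpM2l a0 ve; have := ler_wpM2l b0 v'e.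
      have -> : b = 1 - a by [lra].
      lra.
    have b1 : b = 1 - a by lra.
    split.
    + by apply: coneD => //; exact: coneZ.
    + by apply: (ceq (coneD HK (coneZ HK a0 xg) (coneZ HK b0 yg)));
        rewrite b1; lmod R.
    + exists (a *: p + b *: q); split; first exact: tail_hull_convex.
        rewrite (_ : _ - g0 = a *: (p.2 - g0) + b *: (q.2 - g0)); first exact: cvx_le.
        by rewrite /= b1; lmod R.
      rewrite (_ : _ - _ = a *: (p.1 - x) + b *: (q.1 - y)); first exact: cvx_le.
      by rewrite /=; lmod R.
  - move=> x [Kx xg [p [Wp pg px]]]; split => //; exists p.
    have le : 2^-1 ^+ n.+1 <= 2^-1 ^+ n :> R by have := E n; rewrite exprS; lra.
    split; [exact: tail_hull_sub Wp|exact: le_trans pg le|exact: le_trans px le].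
  - by move=> x [].
have [c cB] := nested_cluster BL OC Bnest.
exists c => n e e0; have [m me] := half_pow_small 2 e0.
have [|b [Kb bg [p [Wp pg pb]]] bc] := cB (n + m)%N (e / 2); first by lra.
exists p.1; first by apply: (tail_hull_sub (leq_addr m n)); exact: W_h Wp.
have : 2^-1 ^+ (n + m) <= 2^-1 ^+ m :> R.
  by rewrite exprD ler_piMl ?(ltW (E m))// exprn_ile1//; lra.
by have := ler_distD b p.1 c; lra.
Qed.

End dominated.

(** * Transfer from X to the span of the cone of Z *)

Section span_order.
Context {R : realType} {V : lmodType R} {K : set V}.
Hypothesis HK : is_cone K.
Implicit Types x y : span_space K.

Lemma span_valB x y : val (x - y) = val x - val y. Proof. exact: raddfB. Qed.
Lemma span_valD x y : val (x + y) = val x + val y. Proof. exact: raddfD. Qed.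
Lemma span_valN x : val (- x) = - val x. Proof. exact: raddfN. Qed.
Lemma span_valZ a x : val (a *: x) = a *: val x. Proof. by []. Qed.
Lemma span_val0 : val (0 : span_space K) = 0. Proof. exact: raddf0. Qed.

Lemma span_coneE x : @span_cone R V K x = K (val x). Proof. by []. Qed.

Lemma span_cone_le x y :
  cone_le (@span_cone R V K) x y <-> cone_le K (val x) (val y).
Proof. by rewrite /cone_le span_coneE span_valB. Qed.

Lemma cone_lin_span (v : V) : K v -> v \in lin_span K.
Proof.
move=> Kv; rewrite lin_span_coneE// inE; exists v, 0.
by rewrite subr0; split => //; exact: cone0.
Qed.

Lemma lin_spanB (u v : V) : u \in lin_span K -> v \in lin_span K ->
  u - v \in lin_span K.
Proof. exact: rpredB. Qed.

Lemma lin_spanD (u v : V) : u \in lin_span K -> v \in lin_span K ->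
  u + v \in lin_span K.
Proof. exact: rpredD. Qed.

Lemma span_cone_is_cone : is_cone (@span_cone R V K).
Proof.
split.
- by exists 0; rewrite span_coneE span_val0; exact: cone0.
- move=> a b x y a0 b0 Kx Ky; rewrite span_coneE span_valD !span_valZ.
  by apply: coneD => //; exact: coneZ.
- apply/seteqP; split => [x [Kx [y Ky yx]]|_ ->] /=.
    apply: val_inj; apply: (cone_anti HK); first exact: Kx.
    by rewrite -yx span_valN opprK.
  have K0 : K (val (0 : span_space K)) by rewrite span_val0; exact: cone0.
  by split => //; exists 0; rewrite ?oppr0.
Qed.

Lemma span_decomposition x : exists y z : V, [/\ K y, K z & val x = y - z].
Proof. by have := span_valP x; rewrite lin_span_coneE// inE. Qed.

End span_order.

(** A Cauchy filter contains sets [A n] of diameter at most [2^-1 ^+ n]. Points chosen in the finite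
    intersections [B n] form a rapidly Cauchy sequence whose limit is that of the filter. *)
Lemma complete_geometric {R : realType} (V : normedModType R) :
  (forall u : nat -> V, (forall n, `|u n.+1 - u n| <= 2^-1 ^+ n) ->
    exists l : V, u n @[n --> \oo] --> l) ->
  forall F : set_system V, ProperFilter F -> cauchy F -> cvg F.
Proof.
move=> cplt F FF /cauchy_ballP Fc.
have E n : 0 < 2^-1 ^+ n :> R by apply: exprn_gt0; lra.
have /choice[A AP] n : exists A, F A /\
    forall x y, A x -> A y -> `|x - y| <= 2^-1 ^+ n.
  have [[A B] /= [FA FB] AB] := Fc _ (E n).
  exists (A `&` B); split; first exact: filterI.
  move=> x y [Ax _] [_ By]; have := AB (x, y) (conj Ax By).
  by rewrite -ball_normE /= => /ltW.
have FA n := (AP n).1; have AE n := (AP n).2.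
pose B n := [set x | forall k, (k <= n)%N -> A k x].
have FB n : F (B n).
  elim: n => [|n IH].
    by apply: filterS (FA 0%N) => x Ax k; rewrite leqn0 => /eqP->.
  apply: filterS (filterI IH (FA n.+1)) => x [Bx Ax] k.
  by rewrite leq_eqVlt => /predU1P[->|]; [|exact: Bx].
have /choice[u uB] n : exists x, B n x by exact: filter_ex (FB n).
have [n|l /seq_cvgP ul] := cplt u; first by apply: AE; exact: uB.
apply/cvg_ex; exists l; apply/cvgrPdist_le => e e0.
have [k ke] := half_pow_small 2 e0.
have [N uN] := ul _ (E k).
apply: filterS (FA k) => x Ax.
have := AE k _ _ (uB (maxn N k) k (leq_maxr _ _)) Ax.
have := uN _ (leq_maxl N k); rewrite distrC.
by have := ler_distD (u (maxn N k)) l x; lra.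
Qed.

Section transfer.
Context {R : realType} {X Z : completeNormedModType R} {XK : set X} {ZK : set Z}.
Context {S : {linear Z -> X}} {J : {linear X -> Z}} {R_ : nat -> {linear Z -> X}}.
Hypotheses (XBL : banach_lattice XK) (XOC : order_continuous_norm XK).
Hypothesis ZOB : ordered_banach ZK.
Hypotheses (Sb : bounded_fun_norm S) (S_pos : positive_map ZK XK S) (Sbij : bijective S).
Hypotheses (Jb : bounded_fun_norm J) (J_pos : positive_map XK ZK J).
Hypothesis R_pos : forall n, positive_map ZK XK (R_ n).
Hypothesis JR : strong_op_cvg (fun n => J \o R_ n) idfun.

Let XC : is_cone XK. Proof. by have [[]] := XBL. Qed.
Let Xcl : closed XK. Proof. by have [[]] := XBL. Qed.
Let XL : vector_lattice XK. Proof. by have [] := XBL. Qed.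
Let ZC : is_cone ZK. Proof. by have [] := ZOB. Qed.
Let Zcl : closed ZK. Proof. by have [] := ZOB. Qed.
Let WC : is_cone (@span_cone R Z ZK). Proof. exact: span_cone_is_cone. Qed.
Local Notation W := (span_space ZK).
Local Notation WK := (@span_cone R Z ZK).
Local Notation zeq := (@cone_eq _ _ ZK _ _).
Local Notation xeq := (@cone_eq _ _ XK _ _).
Local Notation weq := (@cone_eq _ _ WK _ _).

Lemma JRweak v : weak_cvg (fun n => J (R_ n v)) v.
Proof. by apply: norm_cvg_weak; exact: JR. Qed.

Lemma positive_sup2 x y : ZK x -> ZK y -> exists z, is_sup2 ZK x y z.
Proof.
move=> Kx Ky; have [C C0 SC] := linear_bijection_inverse_bounded Sb Sbij.
pose w n := J (vsup XK (R_ n x) (R_ n y)).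
have JRw n v : cone_le XK (R_ n v) (vsup XK (R_ n x) (R_ n y)) ->
    cone_le ZK (J (R_ n v)) (w n).
  by move=> /J_pos; rewrite linearB.
have xw n : cone_le ZK (J (R_ n x)) (w n) by apply: JRw; exact: vsup_ge1.
have yw n : cone_le ZK (J (R_ n y)) (w n) by apply: JRw; exact: vsup_ge2.
have wu u n : cone_le ZK x u -> cone_le ZK y u -> cone_le ZK (w n) (J (R_ n u)).
  move=> xu yu; have Rxu : cone_le XK (R_ n x) (R_ n u).
    by have := @R_pos n _ xu; rewrite linearB.
  have Ryu : cone_le XK (R_ n y) (R_ n u) by have := @R_pos n _ yu; rewrite linearB.
  by have /J_pos := vsup_le XL Rxu Ryu; rewrite linearB.
have KJ n v : ZK v -> ZK (J (R_ n v)) by move=> Kv; apply: J_pos; exact: R_pos.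
have Kw n : ZK (w n) by apply: (zeq (coneD ZC (KJ n x Kx) (xw n))); lmod R.
have xxy : cone_le ZK x (x + y) by apply: (zeq Ky); lmod R.
have yxy : cone_le ZK y (x + y) by apply: (zeq Kx); lmod R.
(* Since [x + y] is an upper bound of [x] and [y], the sequence [S \o w] is dominated by one
   converging to [S (x + y)]. *)
have [n|n||c cw] := @dominated_convex_cluster R X XK XBL XOC (S \o w)
  (fun n => S (J (R_ n (x + y)))) (S (x + y)).
- exact: S_pos.
- by have /S_pos := wu _ n xxy yxy; rewrite linearB.
- by apply: norm_cvg_weak; apply: bounded_linear_cvg => //; exact: JR.
have [T TS ST] := Sbij.
(* Boundedness of the inverse of [S] brings the cluster point back to [Z], where the inequalities
   are checked. *)
rewrite -(ST c) in cw; have wz := convex_cluster_preimage C0 SC cw.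
exists (T c); split.
- exact: (convex_cluster_ge ZC Zcl xw (@JRweak x) wz).
- exact: (convex_cluster_ge ZC Zcl yw (@JRweak y) wz).
move=> u xu yu.
exact: (convex_cluster_le ZC Zcl (fun n => wu u n xu yu) (@JRweak u) wz).
Qed.

(** Translation by [x2 + y2] reduces to positive elements; the supremum stays in the span because it
    is [val x] plus an element of the cone. *)
Lemma span_vector_lattice : vector_lattice WK.
Proof.
move=> x y; have [x1 [x2 [Kx1 Kx2 xE]]] := span_decomposition ZC x.
have [y1 [y2 [Ky1 Ky2 yE]]] := span_decomposition ZC y.
have [s] := positive_sup2 (coneD ZC Kx1 Ky2) (coneD ZC Ky1 Kx2).
move=> /(is_sup2_shift ZC (- (x2 + y2))).
have -> : x1 + y2 - (x2 + y2) = val x by rewrite xE; lmod R.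
have -> : y1 + x2 - (x2 + y2) = val y by rewrite yE; lmod R.
set t := s - (x2 + y2) => -[xt yt tl].
have t_span : t \in lin_span ZK.
  have -> : t = val x + (t - val x) by lmod R.
  by apply: lin_spanD; [exact: span_valP|exact: cone_lin_span].
exists (SpanSpace t_span); split.
- exact/span_cone_le.
- exact/span_cone_le.
- move=> u /span_cone_le xu /span_cone_le yu; apply/span_cone_le; exact: tl.
Qed.

Let WL := span_vector_lattice.

(** * The lattice norm on the span and its completeness *)

Definition span_lattice_norm (x : W) : R := `|S (val (vabs WK x))|.
Local Notation p := span_lattice_norm.

Lemma span_lattice_norm_pos x : WK x -> p x = `|S (val x)|.
Proof. by move=> Kx; rewrite /p vabs_id. Qed.

Lemma S_span_le x y : cone_le WK x y -> cone_le XK (S (val x)) (S (val y)).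
Proof. by move=> /span_cone_le/S_pos; rewrite linearB. Qed.

Lemma span_lattice_norm_le x y :
  cone_le WK (vabs WK x) (vabs WK y) -> p x <= p y.
Proof.
move=> xy; apply: (norm_le_cone XBL); last exact: S_span_le.
by apply: S_pos; exact: (vabs_pos WC WL).
Qed.

Lemma span_lattice_norm_ge x : `|S (val x)| <= p x.
Proof.
rewrite /p -[leLHS](norm_vabs XBL); apply: (norm_le_cone XBL); first exact: vabs_pos.
apply: vabs_le => //; first by apply: S_span_le; exact: vabs_ge.
by rewrite -linearN -span_valN; apply: S_span_le; exact: vabs_geN.
Qed.

Lemma span_lattice_norm_is_norm : is_norm p.
Proof.
have [C C0 SC] := linear_bijection_inverse_bounded Sb Sbij.
split.
- move=> x y; apply: (@le_trans _ _ `|S (val (vabs WK x + vabs WK y))|).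
    apply: (norm_le_cone XBL); first by apply: S_pos; exact: (vabs_pos WC WL).
    by apply: S_span_le; exact: vabsD.
  by rewrite span_valD linearD; exact: ler_normD.
- move=> a x; rewrite /p (vabsZ WC WL).
  by rewrite span_valZ linearZ normrZ normr_id.
- move=> x px0; apply: (vabs_eq0 WC WL); apply: val_inj; rewrite span_val0.
  by apply/eqP; rewrite -normr_le0; apply: le_trans (SC _) _; rewrite -/(p x) px0 mulr0.
Qed.

Let hp := span_lattice_norm_is_norm.

Lemma span_lattice_normN x : p (- x) = p x.
Proof. by rewrite /p (vabsN WC WL). Qed.

(** The lower estimate uses the decomposition into positive and negative parts, each of norm at most
    [C * p x]. The upper one uses [|x| <= y + z] whenever [x = y - z] with [y] and [z] in the
    cone. *)
Lemma span_lattice_norm_equivalent : equivalent_norms p (@span_norm R Z ZK).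
Proof.
have [C C0 SC] := linear_bijection_inverse_bounded Sb Sbij.
have [B B0 SB] := bounded_norm_le Sb.
exists (2 * C)^-1, B; split => //; first by rewrite invr_gt0; lra.
move=> x; rewrite /span_norm; set A := [set r | _].
have A_lb : has_lbound A.
  by exists 0 => _ [y [z [_ _ _ ->]]]; rewrite addr_ge0.
have A_ne : A !=set0.
  have [y [z [Ky Kz xE]]] := span_decomposition ZC x.
  by exists (`|y| + `|z|), y, z.
apply/andP; split.
  rewrite ler_pdivrMl; last by lra.
  have pos y : cone_le WK (vpos WK y) (vabs WK y) by exact: vpos_le_abs.
  have le y : p y = p x -> `|val (vpos WK y)| <= C * p x.
    move=> <-; apply: le_trans (SC _) _; rewrite ler_pM2l//.
    apply: (norm_le_cone XBL); last exact: S_span_le.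
    by apply: S_pos; exact: (vpos_pos WL).
  have : inf A <= `|val (vpos WK x)| + `|val (vpos WK (- x))|.
    apply: ge_inf => //; exists (val (vpos WK x)), (val (vpos WK (- x))); split => //.
    - exact: (vpos_pos WL).
    - exact: (vpos_pos WL).
    - by rewrite {1}(vposBN WC WL x) span_valB.
  have := le x erefl; have := le (- x) (span_lattice_normN x); lra.
rewrite -ler_pdivrMl//; apply: lb_le_inf => // _ [y [z [Ky Kz xE ->]]].
rewrite ler_pdivrMl//.
pose y' := SpanSpace (cone_lin_span ZC Ky); pose z' := SpanSpace (cone_lin_span ZC Kz).
have y'E : val y' = y by [].
have z'E : val z' = z by [].
apply: (@le_trans _ _ `|S (val (y' + z'))|).
  apply: (norm_le_cone XBL); first by apply: S_pos; exact: (vabs_pos WC WL).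
  apply: S_span_le; apply: vabs_le => //; apply/span_cone_le;
    rewrite ?span_valN span_valD xE y'E z'E.
    by apply: (zeq (coneD ZC Kz Kz)); lmod R.
  by apply: (zeq (coneD ZC Ky Ky)); lmod R.
rewrite span_valD linearD; apply: le_trans (ler_normD _ _) _.
by rewrite mulrDr lerD.
Qed.

(** The limit is the preimage [z] of [xi] under [S]. As the inverse of [S] need not be positive,
    [x i <= z] comes from norm convergence in [Z] and closedness of [ZK]; the lattice norm of the
    positive element [z - x i] is then just [|S (z - x i)|]. *)
Lemma increasing_net_span_cvg (T : Type) (le : T -> T -> Prop) (x : T -> W) (xi : X) :
  directed le -> increasing_net WK le x ->
  (fun i => S (val (x i))) @ net_tails le --> xi ->
  exists l : W, forall i, p (x i - l) = `|S (val (x i)) - xi|.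
Proof.
move=> [[i0] _ _ dir] x_inc /net_cvgP x_xi.
have [C C0 SC] := linear_bijection_inverse_bounded Sb Sbij.
have [T' TS ST] := Sbij; set z := T' xi.
have xz i : ZK (z - val (x i)).
  apply: (closed_approx Zcl) => e e0.
  have [j jxi] := x_xi _ (divr_gt0 e0 C0); have [k [ik jk]] := dir i j.
  exists (val (x k) - val (x i)); first by apply/span_cone_le; exact: x_inc.
  have -> : val (x k) - val (x i) - (z - val (x i)) = val (x k) - z by lmod R.
  apply: le_trans (SC _) _; rewrite linearB ST mulrC -ler_pdivlMr//.
  exact/ltW/jxi.
have z_span : z \in lin_span ZK.
  have -> : z = val (x i0) + (z - val (x i0)) by lmod R.
  by apply: lin_spanD; [exact: span_valP|exact: cone_lin_span].
exists (SpanSpace z_span) => i.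
rewrite -span_lattice_normN opprB span_lattice_norm_pos; last first.
  by rewrite span_coneE span_valB; exact: xz.
by rewrite span_valB linearB ST distrC.
Qed.

Lemma increasing_net_renormed_cvg (T : Type) (le : T -> T -> Prop)
    (x : T -> renormed hp) (xi : X) :
  directed le -> increasing_net WK le x ->
  (fun i => S (val (x i : W))) @ net_tails le --> xi ->
  exists l : renormed hp, x @ net_tails le --> l.
Proof.
move=> dir x_inc x_xi; have [l lE] := increasing_net_span_cvg dir x_inc x_xi.
exists l; apply/net_cvgP => e e0; have /net_cvgP/(_ e e0)[i xi_i] := x_xi.
by exists i => j ij; rewrite renormedE [p _]lE; exact: xi_i.
Qed.

(** The increments of a rapidly Cauchy sequence are split into positive and negative parts. Each
    series of positive terms has increasing partial sums whose images under [S] converge in [X], so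
    it converges in the span. *)
Lemma renormed_complete (F : set_system (renormed hp)) :
  ProperFilter F -> cauchy F -> cvg F.
Proof.
apply: complete_geometric => u uE {F}.
(* The sequence is viewed in [W], where the vector space operations of the span apply directly. *)
have [u' u'E] : exists u' : nat -> W, u' = u by exists u.
pose d n : W := u' n.+1 - u' n.
have sum_cvg (a : nat -> W) : (forall n, WK (a n)) -> (forall n, p (a n) <= 2^-1 ^+ n) ->
    exists (s : nat -> W) (l : W), [/\ s 0%N = 0, forall n, s n.+1 = s n + a n &
      forall e : R, 0 < e -> exists N, forall n, (N <= n)%N -> p (s n - l) <= e].
  move=> Ka aE; pose s n : W := \sum_(k < n) a k.
  have sS n : s n.+1 = s n + a n by rewrite /s big_ord_recr.
  have [n|xi sxi] := @geometric_cvg R X (fun n => S (val (s n))) 1.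
    rewrite mul1r -linearB -span_valB sS addrAC subrr add0r.
    by rewrite -span_lattice_norm_pos.
  have [|||l sl] := @increasing_net_renormed_cvg _ (fun i j => (i <= j)%N) s xi.
  - split=> [|//|i j k|i j]; first exact: inhabits 0%N.
      exact: leq_trans.
    by exists (maxn i j); rewrite leq_maxl leq_maxr.
  - move=> m n mn; rewrite -(subnK mn); elim: (n - m)%N => [|k IH].
      exact: cle_refl.
    apply: (cle_trans WC IH); rewrite addSn sS.
    by apply: (weq (Ka (k + m)%N)); lmod R.
  (* The last factor [2] makes the bound [2 * 1 * 2^-1 ^+ n] strictly less than [e]. *)
  - apply/net_cvgP => e e0; have [k ke] := half_pow_small (2 * 1 * 2) e0.
    have E : 0 < 2^-1 ^+ k :> R by apply: exprn_gt0; lra.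
    exists k => n kn; apply: le_lt_trans (sxi n) _.
    have : 2^-1 ^+ n <= 2^-1 ^+ k :> R.
      by rewrite -(subnK kn) exprD ler_piMl ?(ltW E)// exprn_ile1//; lra.
    lra.
  exists s, l; split; [by rewrite /s big_ord0|by []|move=> e e0].
  have /net_cvgP/(_ e e0)[N sN] := sl.
  by exists N => n /sN/ltW.
have dE n : p (d n) <= 2^-1 ^+ n by rewrite /d u'E; exact: uE.
have pos_le y : p (vpos WK y) <= p y.
  apply: span_lattice_norm_le; rewrite [vabs _ (vpos _ _)](vabs_id WC WL).
    exact: vpos_le_abs.
  exact: (vpos_pos WL).
have [d1 d1E] : exists d1 : nat -> W, forall n, d1 n = vpos WK (d n).
  by exists (fun n => vpos WK (d n)).
have [d2 d2E] : exists d2 : nat -> W, forall n, d2 n = vpos WK (- d n).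
  by exists (fun n => vpos WK (- d n)).
have [n|n|s [a [s0 sS sa]]] := sum_cvg d1.
- by rewrite d1E; exact: (vpos_pos WL).
- by rewrite d1E; exact: le_trans (pos_le _) (dE n).
have [n|n|t [b [t0 tS tb]]] := sum_cvg d2.
- by rewrite d2E; exact: (vpos_pos WL).
- by rewrite d2E; apply: le_trans (pos_le _) _; rewrite span_lattice_normN.
have uE' n : u' n = u' 0%N + (s n - t n).
  elim: n => [|n IH]; first by rewrite s0 t0 subrr addr0.
  have dn : d n = d1 n - d2 n by rewrite d1E d2E; exact: vposBN.
  have -> : u' n.+1 = u' n + d n by rewrite /d; lmod R.
  by rewrite sS tS IH dn; lmod R.
exists (u' 0%N + (a - b) : W); apply/seq_cvgP => e e0.
have e2 : 0 < e / 2 by lra.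
have [N sN] := sa _ e2; have [M tM] := tb _ e2.
exists (maxn N M) => n; rewrite geq_max => /andP[/sN sn /tM tn].
rewrite renormedE [p _](_ : _ = p ((s n - a) - (t n - b))).
  have [pD _ _] := span_lattice_norm_is_norm.
  by have := pD (s n - a) (- (t n - b)); rewrite span_lattice_normN; lra.
congr (p _); rewrite -u'E uE'.
by rewrite -[LHS]/((u' 0%N + (s n - t n)) - (u' 0%N + (a - b))); lmod R.
Qed.

(** Closedness is inherited from [ZK], because [|z| <= C * |S z|] and [|S z|] is at most the lattice
    norm. *)
Lemma renormed_closed_cone : closed (WK : set (renormed hp)).
Proof.
move=> x xcl; rewrite span_coneE; apply: (closed_approx Zcl) => e e0.
have [C C0 SC] := linear_bijection_inverse_bounded Sb Sbij.
have [a [Ka]] := xcl _ (nbhsx_ballx (x : renormed hp) _ (divr_gt0 e0 C0)).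
rewrite -ball_normE /= distrC renormedE => xa.
exists (val (a : W)) => //; rewrite -span_valB; apply: le_trans (SC _) _.
rewrite mulrC -ler_pdivlMr//; apply: le_trans (span_lattice_norm_ge _) _.
exact: ltW.
Qed.

Lemma renormed_banach_lattice : @banach_lattice R (renormed hp) WK.
Proof.
split.
- by split; [exact: renormed_complete|exact: WC|exact: renormed_closed_cone].
- exact: WL.
move=> x y a b xa yb ab.
apply: (@span_lattice_norm_le x y).
have -> : vabs WK (x : W) = a := vsupE WC WL xa.
have -> : vabs WK (y : W) = b := vsupE WC WL yb.
exact: ab.
Qed.

Lemma renormed_order_continuous : @order_continuous_norm R (renormed hp) WK.
Proof.
move=> T le x dir Kx x_inc [a [b xab]].
have [||||xi x_xi] := XOC (le := le) (x := fun i => S (val (x i : W))).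
- exact: dir.
- by move=> i; apply: S_pos; exact: Kx.
- by move=> i j ij; apply: S_span_le; exact: x_inc.
- exists (S (val (a : W))), (S (val (b : W))) => i.
  by have [ax xb] := xab i; split; exact: S_span_le.
exact: increasing_net_renormed_cvg x_xi.
Qed.

Lemma renormed_KB : KB_space XK -> @KB_space R (renormed hp) WK.
Proof.
move=> [_ XKB]; split; first exact: renormed_banach_lattice.
move=> T le x dir x_inc [M [_ xM]].
have [|||xi x_xi] := XKB T le (fun i => S (val (x i : W))).
- exact: dir.
- by move=> i j ij; apply: S_span_le; exact: x_inc.
- exists (M + 1); split; first exact: num_real.
  move=> N MN i _; apply: le_trans (span_lattice_norm_ge _) _.
  by apply: xM => //; lra.
exact: increasing_net_renormed_cvg x_xi.
Qed.

(** * The operator [J] with values in the span, and its image *)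

Lemma image_lin_span x : J x \in lin_span ZK.
Proof.
rewrite (vposBN XC XL x) linearB.
by apply: lin_spanB; apply: cone_lin_span => //; apply: J_pos; exact: vpos_pos.
Qed.

Definition span_corestriction x : W := SpanSpace (image_lin_span x).

Lemma span_corestriction_linear : linear span_corestriction.
Proof.
move=> a x y; apply: val_inj; rewrite span_valD span_valZ.
by rewrite -[LHS]/(J _) linearP.
Qed.

HB.instance Definition _ := GRing.isLinear.Build R X W *:%R span_corestriction
  span_corestriction_linear.

Local Notation J' := span_corestriction.

Section weak_left_inverse.
Hypothesis RJ : weak_op_cvg (fun n => R_ n \o J) idfun.

Lemma RJweak x : weak_cvg (fun n => R_ n (J x)) x.
Proof. by move=> phi phib; exact: RJ. Qed.

(** The preimage [c] is a cluster point of [R_ n z]. Its last property holds for every [b'], not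
    only for [b]: [R_ n z] is below [R_ n (J b')], which tends weakly to [b']. This minimality
    yields the homomorphism property. *)
Lemma dominated_image z b : ZK z -> cone_le ZK z (J b) ->
  exists c, [/\ J c = z, XK c &
    forall b', cone_le ZK z (J b') -> cone_le XK c b'].
Proof.
move=> Kz zb.
have zR b' n : cone_le ZK z (J b') -> cone_le XK (R_ n z) (R_ n (J b')).
  by move=> zb'; have := @R_pos n _ zb'; rewrite linearB.
have [n|n||c cR] := @dominated_convex_cluster R X XK XBL XOC (fun n => R_ n z)
  (fun n => R_ n (J b)) b.
- exact: R_pos.
- exact: zR.
- exact: RJweak.
exists c; split.
- have JRz : (J \o (fun n => R_ n z)) n @[n --> \oo] --> z := @JR z.
  exact: (convex_cluster_unique ZC Zcl JRz (convex_cluster_linear Jb cR)).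
- apply/(@cle0 _ _ XK).
  apply: (convex_cluster_ge XC Xcl (r := fun=> 0) _ _ cR).
    by move=> n; apply/cle0; exact: R_pos.
  by apply: norm_cvg_weak; exact: cvg_cst.
- move=> b' zb'.
  exact: (convex_cluster_le XC Xcl (fun n => zR b' n zb') (@RJweak b') cR).
Qed.

Lemma span_corestriction_le x y : cone_le XK x y -> cone_le WK (J' x) (J' y).
Proof. by move=> xy; apply/span_cone_le; have := J_pos xy; rewrite linearB. Qed.

(** Let [w] be the supremum of the images. The defect [z = J s - w] is below both [J (s - x)] and
    [J (s - y)], so its minimal preimage [c] is below [s - x] and [s - y]. Hence [s - c] is an upper
    bound of [x] and [y], which forces [c = 0]. *)
Lemma span_corestriction_sup2 x y s :
  is_sup2 XK x y s -> is_sup2 WK (J' x) (J' y) (J' s).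
Proof.
move=> [xs ys sl].
have ws : cone_le WK (vsup WK (J' x) (J' y)) (J' s).
  by apply: vsup_le => //; exact: span_corestriction_le.
have [xw yw _] := vsupP WL (J' x) (J' y).
move: ws xw yw; set w := vsup _ _ _ => ws xw yw.
have [v vE] : exists v : Z, v = val w by exists (val w).
pose z := J s - v.
have Kz : ZK z by rewrite /z vE; move/span_cone_le: ws.
have zJ t : cone_le WK (J' t) w -> cone_le ZK z (J (s - t)).
  move=> /span_cone_le tw; have {}tw : cone_le ZK (J t) v by rewrite vE.
  have -> : J (s - t) = J s - J t by exact: linearB.
  by apply: (zeq tw); rewrite /z; lmod R.
have [c [Jc Kc c_le]] := dominated_image Kz (zJ x xw).
have c0 : c = 0.
  apply: (cone_anti XC) => //.
  have xc : cone_le XK x (s - c) by apply: (xeq (c_le _ (zJ x xw))); lmod R.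
  have yc : cone_le XK y (s - c) by apply: (xeq (c_le _ (zJ y yw))); lmod R.
  by apply: (xeq (sl _ xc yc)); lmod R.
have -> : J' s = w.
  apply: val_inj; apply/eqP; rewrite -subr_eq0; apply/eqP.
  by rewrite -vE -[LHS]/z -Jc c0 linear0.
exact: vsupP.
Qed.

Lemma span_corestriction_homomorphism :
  lattice_homomorphism XK WK (J' : {linear X -> W}).
Proof.
split=> x y s; first exact: span_corestriction_sup2.
move=> /is_inf2_sup2N/span_corestriction_sup2; rewrite !linearN.
by move=> /is_inf2_sup2N.
Qed.

(** If [|x| <= |J' v| = J' |v|], the positive and negative parts of [x] both lie between 0 and
    [J' |v|], hence are images. *)
Lemma span_corestriction_ideal : lattice_ideal WK (range J').
Proof.
split.
  split=> [|a u v]; rewrite !inE; first by exists 0; rewrite ?linear0.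
  by move=> [x _ <-] [y _ <-]; exists (a *: x + y); rewrite ?linearP.
move=> x y a b xa yb ab [v _ vy].
have bE : b = J' (vabs XK v).
  apply: (is_sup2_unique WC yb); rewrite -vy -linearN.
  exact: span_corestriction_sup2 (vsupP XL v (- v)).
have pos_image u : cone_le WK u a -> WK u -> exists c, J' c = u.
  move=> ua Ku; have /span_cone_le := cle_trans WC ua ab; rewrite bE => ub.
  have [c [Jc _ _]] := dominated_image Ku ub.
  by exists c; exact: val_inj.
have aE : vabs WK x = a := vsupE WC WL xa.
have [||c cE] := pos_image (vpos WK x).
- by rewrite -aE; exact: vpos_le_abs.
- exact: (vpos_pos WL).
have [||d dE] := pos_image (vpos WK (- x)).
- by rewrite -aE -[vabs WK x](vabsN WC WL); exact: vpos_le_abs.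
- exact: (vpos_pos WL).
have J'B : J' (c - d) = J' c - J' d by apply: val_inj; rewrite span_valB; exact: linearB.
by exists (c - d) => //; rewrite J'B cE dE -(vposBN WC WL).
Qed.

End weak_left_inverse.

End transfer.

Theorem theorem2p8 (R : realType) (X Z : completeNormedModType R)
    (XK : set X) (ZK : set Z)
    (S : {linear Z -> X}) (J : {linear X -> Z}) (R_ : nat -> {linear Z -> X}) :
  banach_lattice XK -> order_continuous_norm XK ->
  ordered_banach ZK ->
  bounded_fun_norm S -> positive_map ZK XK S -> bijective S ->
  bounded_fun_norm J -> positive_map XK ZK J ->
  (forall n, bounded_fun_norm (R_ n)) ->
  (forall n, positive_map ZK XK (R_ n)) ->
  strong_op_cvg (fun n => J \o R_ n) idfun ->
  (exists (p : span_space ZK -> R) (hp : is_norm p),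
    [/\ equivalent_norms p (@span_norm R Z ZK),
        @banach_lattice R (renormed hp) (@span_cone R Z ZK),
        @order_continuous_norm R (renormed hp) (@span_cone R Z ZK)
      & KB_space XK -> @KB_space R (renormed hp) (@span_cone R Z ZK)]) /\
  (weak_op_cvg (fun n => R_ n \o J) idfun ->
    exists J' : {linear X -> span_space ZK},
      [/\ forall x, val (J' x) = J x,
          lattice_homomorphism XK (@span_cone R Z ZK) J'
        & lattice_ideal (@span_cone R Z ZK) (range J')]).
Proof.
move=> XBL XOC ZOB Sb S_pos Sbij Jb J_pos _ R_pos JR; split.
  exists (@span_lattice_norm R X Z ZK S).
  exists (span_lattice_norm_is_norm XBL XOC ZOB Sb S_pos Sbij J_pos R_pos JR); split.
  - exact: (span_lattice_norm_equivalent XBL XOC ZOB Sb S_pos Sbij J_pos R_pos JR).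
  - exact: (renormed_banach_lattice XBL XOC ZOB Sb S_pos Sbij J_pos R_pos JR).
  - exact: (@renormed_order_continuous R X Z XK ZK S J R_
      XBL XOC ZOB Sb S_pos Sbij J_pos R_pos JR).
  - exact: (renormed_KB XBL XOC ZOB Sb S_pos Sbij J_pos R_pos JR).
move=> RJ; exists (span_corestriction XBL ZOB J_pos); split=> //.
- exact: span_corestriction_homomorphism.
- exact: span_corestriction_ideal.
Qed.
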